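(* Let $C_n=\frac{1}{n+1}\binom{2n}{n}=\frac{(2n)!}{n!(n+1)!}$, $n=0,1,2,\ldots$, be the Catalan numbers. Then: (a) $\{C_n\}_{n=0}^{\infty}$ is an infinitely divisible Stieltjes moment sequence. (b) For each real $c>0$, the power sequence $\{C_n^c\}_{n=0}^{\infty}$ is Stieltjes determinate. (c) For each real $c>0$, the (unique) measure $\mu_c$ on $[0,\infty)$ with moment sequence $\{C_n^c\}_{n=0}^{\infty}$ (where $\mu_1$ is the measure with density $\frac{1}{2\pi}\sqrt{\frac{4-x}{x}}$ on $(0,4]$) has Mellin transform $$\mathcal{M}_c(s)\equiv\int_0^{\infty}t^s\,d\mu_c(t)=\left(\frac{2^{2s}}{\sqrt{\pi}}\cdot\frac{\Gamma(s+1/2)}{\Gamma(s+2)}\right)^c=\left(\frac{1}{s+1}\cdot\frac{\Gamma(2s+1)}{(\Gamma(s+1))^2}\right)^c,\quad s\ge 0.$$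
   Context: A real sequence $\{m_n\}_{n=0}^\infty$ is a Stieltjes moment sequence if there is a nonnegative measure $\mu$ on $[0,\infty)$ with $m_n=\int_{[0,\infty)}x^n\,d\mu(x)$ for all $n\ge0$; it is Stieltjes determinate (S-det) if such $\mu$ is unique, and Stieltjes indeterminate otherwise. A Stieltjes moment sequence $\{m_n\}$ is infinitely divisible (in the sense of Tyan) if $\{m_n^c\}_{n=0}^\infty$ is a Stieltjes moment sequence for every real $c>0$. *)

(* Defs.v *)
From HB Require Import structures.
From mathcomp Require Import all_boot all_order all_algebra.
From mathcomp Require Import all_classical all_reals all_analysis.
From mathcomp Require Import ring.

Set Implicit Arguments.
Unset Strict Implicit.
Unset Printing Implicit Defensive.

Import Order.TTheory GRing.Theory Num.Theory.
Import numFieldNormedType.Exports.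

Local Open Scope classical_set_scope.
Local Open Scope ring_scope.

(* A measure on [0, +oo[ is encoded as a Borel measure on the line that gives
   mass 0 to ]-oo, 0[. The integral is extended-real valued with a nonnegative
   integrand, so the equation also says that all the moments are finite. *)
Definition stieltjes_represents (R : realType)
    (mu : {measure set (measurableTypeR R) -> \bar R}) (m : nat -> R) : Prop :=
  mu `]-oo, 0[%classic = 0%E /\
  forall n : nat, (\int[mu]_(x in `[0%R, +oo[) (x ^+ n)%:E = (m n)%:E)%E.

Definition stieltjes_moment (R : realType) (m : nat -> R) : Prop :=
  exists mu : {measure set (measurableTypeR R) -> \bar R},
    stieltjes_represents mu m.

Definition stieltjes_determinate (R : realType) (m : nat -> R) : Prop :=
  stieltjes_moment m /\
  forall mu nu : {measure set (measurableTypeR R) -> \bar R},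
    stieltjes_represents mu m -> stieltjes_represents nu m ->
    forall A, measurable A -> mu A = nu A.

(* Terms of a Stieltjes moment sequence are nonnegative, so the values of powR
   at a negative base are irrelevant. *)
Definition stieltjes_infinitely_divisible (R : realType) (m : nat -> R) : Prop :=
  stieltjes_moment m /\
  forall c : R, 0 < c -> stieltjes_moment (fun n => m n `^ c).

Definition catalan (R : realType) (n : nat) : R := 'C(n.*2, n)%:R / n.+1%:R.

Lemma catalan_fact (R : realType) (n : nat) :
  catalan R n = n.*2`!%:R / (n`!%:R * n.+1`!%:R).
Proof.
have nz k : k`!%:R != 0 :> R by rewrite pnatr_eq0 -lt0n fact_gt0.
have e : ('C(n.*2, n) * (n`! * n`!) = n.*2`!)%N.
  by rewrite -(@bin_fact n.*2 n) -addnn ?leq_addr// addnK.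
rewrite /catalan -e factS !natrM; field.
by rewrite nz addrC natr1 pnatr_eq0.
Qed.

Definition catalan_density (R : realType) (x : R) : R :=
  (2 * pi)^-1 * Num.sqrt ((4 - x) / x).

(* Meaningful for x > 0; Rintegral returns 0 when the integral diverges. *)
Definition Gamma (R : realType) (x : R) : R :=
  Rintegral (@lebesgue_measure R) `]0, +oo[%classic
    (fun t => t `^ (x - 1) * expR (- t)).

(* The integral of t^s over [0, +oo[, where 0^0 = 1 and 0^s = 0 for s > 0. *)
Definition mellin (R : realType)
    (mu : {measure set (measurableTypeR R) -> \bar R}) (s : R) : \bar R :=
  (\int[mu]_(t in `[0%R, +oo[) (t `^ s)%:E)%E.

(* Main.v *)
Require Import Defs.
From HB Require Import structures.
From mathcomp Require Import all_boot all_order all_algebra.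
From mathcomp Require Import all_classical all_reals all_analysis.
From mathcomp Require Import measurable_realfun.
From mathcomp Require Import ring lra zify.
Import Order.TTheory GRing.Theory Num.Theory.
Import numFieldNormedType.Exports.
Local Open Scope classical_set_scope.
Local Open Scope ring_scope.

Set Implicit Arguments.
Unset Strict Implicit.

(* A measure on [0, +oo[ whose moments are at most K M^n lives on [0, M], and its
   distribution function is the limit of the integrals of the polynomials
   (1 - (x/M)^n)^k with k ~ n (M/t)^n, which decrease from 1 to 0 at x = t. So
   such measures, and hence their Mellin transforms at all real s >= 0, are
   determined by the moments; this gives determinacy, and it turns identities
   between Mellin transforms into recurrences at the integers.
   For the existence of mu_c put
     psi(s) = (s + 1)^(-3/2) exp(rho(s) - rho(0)),
     rho(s) = \int_0^1 v^(2s) (v + 2) / (2 (1 + v)) (1 - v) / (- ln v) dv.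
   A Frullani integral gives psi(n + 1) / psi(n) = (n + 1/2) / (n + 2), whence
   4^n psi(n) = C_n. For every c > 0 the function psi^c is the Laplace transform
   of a gamma law convolved with a compound Poisson law (expand exp(c rho) in a
   power series), so no limit of measures is needed. Finally the measure with
   density sqrt((4 - x) / x) / (2 pi) has Mellin transform a Beta integral and
   the moments C_n, so 4^s psi(s) is the Gamma quotient for all s >= 0. The
   second form of the quotient is Legendre's duplication formula, also obtained
   by comparing moments. *)

(** * Polynomial approximation of a step function *)

Section powers_of_bounded_numbers.
Context {R : realType}.
Implicit Types (q y p : R) (n k : nat).

(** Bernoulli's inequality; it bounds the step polynomials from below on the side where they tend to
    1. *)
Lemma onemX_ge n y : 0 <= y <= 1 -> 1 - n%:R * y <= (1 - y) ^+ n.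
Proof.
move=> /andP[y0 y1]; elim: n => [|n ih]; first by rewrite mul0r subr0 expr0.
rewrite exprS; apply: (@le_trans _ _ ((1 - y) * (1 - n%:R * y))); last first.
  by rewrite ler_wpM2l// subr_ge0.
have : 0 <= n%:R * y ^+ 2 by rewrite mulr_ge0// sqr_ge0.
rewrite -natr1; nra.
Qed.

Lemma onemX_le_expR k y : 0 <= y <= 1 -> (1 - y) ^+ k <= expR (- (k%:R * y)).
Proof.
move=> /andP[y0 y1]; rewrite -mulrN mulrC expRM_natr lerXn2r ?nnegrE ?subr_ge0 ?expR_ge0//.
exact: expR_ge1Dx.
Qed.

(** With q = exp(-a), the bound exp(n a) >= (n a)^2 / 2 gives n q^n <= 2 / (a^2 n). *)
Lemma cvg_natM_expr q : 0 <= q < 1 -> (n%:R * q ^+ n) @[n --> \oo] --> (0 : R).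
Proof.
move=> /andP[q0 q1].
have [->|qn0] := eqVneq q 0.
  apply: (@cvg_near_cst _ _ _ _ _ _).
  near=> n; rewrite expr0n; case: eqP => [n0|_]; last by rewrite mulr0.
  have : (0 < n)%N by near: n; exact: nbhs_infty_gt.
  by rewrite n0.
have qp : 0 < q by rewrite lt_def qn0.
pose a := - ln q; have a0 : 0 < a by rewrite oppr_gt0 ln_lt0// qp.
have qE n : q ^+ n = expR (- (n%:R * a)).
  by rewrite -mulrN opprK mulrC expRM_natr lnK// posrE.
apply: (@squeeze_cvgr _ _ _ _ (cst 0) (fun n => (2 / a ^+ 2) * n%:R^-1)).
- near=> n; rewrite mulr_ge0 ?exprn_ge0//= qE expRN.
  have n0 : 0 < n%:R :> R by rewrite ltr0n; near: n; exact: nbhs_infty_gt.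
  rewrite ler_pdivrMr ?expR_gt0//.
  have := @expR_ge1Dxn R (n%:R * a) 1%N (ltW (mulr_gt0 n0 a0)).
  rewrite (_ : 2`!%:R = 2 :> R) // => h.
  apply: (@le_trans _ _ (2 / a ^+ 2 / n%:R * ((n%:R * a) ^+ 2 / 2))).
    rewrite le_eqVlt; apply/orP; left; apply/eqP; field.
    by rewrite !gt_eqF.
  rewrite ler_wpM2l//; first by rewrite mulr_ge0 ?invr_ge0 ?ler0n// divr_ge0// sqr_ge0.
  by apply: le_trans h; rewrite lerDr.
- exact: cvg_cst.
- rewrite -[X in _ --> X](mulr0 (2 / a ^+ 2)); apply: cvgMr.
  by apply/gtr0_cvgV0; [near=> n; rewrite ltr0n; near: n; exact: nbhs_infty_gt|exact: cvgr_idn].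
Unshelve. all: by end_near.
Qed.

(* The threshold exponent [k n ~ n p^n] makes [(1 - y^n)^(k n)] jump from [1]
   to [0] at [y = 1/p], with value [0] at the jump. *)
Definition step_exponent p n : nat := (Num.truncn (n%:R * p ^+ n)).+1.

(** The exponent is at most n p^n + 1, so by Bernoulli the defect from 1 is at most n (y p)^n + y^n,
    and both terms vanish. *)
Lemma cvg_step_lt p y : 1 <= p -> 0 <= y -> y * p < 1 ->
  ((1 - y ^+ n) ^+ step_exponent p n) @[n --> \oo] --> (1 : R).
Proof.
move=> p1 y0 yp.
have y1 : y < 1 by apply: le_lt_trans yp; rewrite ler_peMr.
have yn n : 0 <= y ^+ n <= 1 by rewrite exprn_ge0//= exprn_ile1// ltW.
apply: (@squeeze_cvgr _ _ _ _
    (fun n => 1 - (n%:R * (y * p) ^+ n + y ^+ n)) (cst 1)).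
- near=> n; apply/andP; split; last first.
    by rewrite exprn_ile1 ?subr_ge0 ?gerBl; have /andP[]:= yn n.
  apply: le_trans (onemX_ge _ (yn n)).
  rewrite lerD2l lerN2 /step_exponent -natr1 mulrDl mul1r lerD2r.
  rewrite exprMn (mulrC (y ^+ n)) mulrA ler_wpM2r//; first by have /andP[]:= yn n.
  by rewrite truncn_le// mulr_ge0// exprn_ge0// (le_trans ler01).
- rewrite -[X in _ --> X]subr0 -[X in _ - X]addr0; apply: cvgB; first exact: cvg_cst.
  apply: cvgD; last by apply: cvg_expr; rewrite ger0_norm.
  by apply: cvg_natM_expr; rewrite yp mulr_ge0// (le_trans ler01).
- exact: cvg_cst.
Unshelve. all: by end_near.
Qed.

(** The exponent exceeds n p^n, so the power is at most exp(-n (y p)^n) <= exp(-n). The factor n is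
    what forces the limit 0 at the jump y p = 1. *)
Lemma cvg_step_ge p y : 1 <= p -> y <= 1 -> 1 <= y * p ->
  ((1 - y ^+ n) ^+ step_exponent p n) @[n --> \oo] --> (0 : R).
Proof.
move=> p1 y1 yp.
have p0 : 0 < p by rewrite (lt_le_trans ltr01).
have y0 : 0 <= y by rewrite -(pmulr_lge0 _ p0) (le_trans ler01).
have yn n : 0 <= y ^+ n <= 1 by rewrite exprn_ge0//= exprn_ile1.
apply: (@squeeze_cvgr _ _ _ _ (cst 0) (fun n => expR (- n%:R))).
- near=> n; rewrite /= exprn_ge0/=; last by rewrite subr_ge0; have /andP[]:= yn n.
  apply: le_trans (onemX_le_expR _ (yn n)) _; rewrite ler_expR lerN2.
  apply: (@le_trans _ _ (n%:R * (y * p) ^+ n)).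
    by rewrite ler_peMr// exprn_ege1.
  rewrite exprMn (mulrC (y ^+ n)) mulrA ler_wpM2r//; first by have /andP[]:= yn n.
  by rewrite ltW// truncnS_gt.
- exact: cvg_cst.
- by move/cvg_pinftyP : (@cvgr_expR R) => /(_ _ cvgr_idn).
Unshelve. all: by end_near.
Qed.

End powers_of_bounded_numbers.

(** * Determinacy of moment sequences of geometric growth *)

Section bounded_moments.
Context {R : realType}.
Implicit Types mu nu : {measure set (measurableTypeR R) -> \bar R}.
Implicit Types m : nat -> R.

Let measurable_EFin_exprn (D : set R) n :
  measurable_fun D (fun x : R => (x ^+ n)%:E).
Proof. by apply/measurable_EFinP; exact: measurable_funX. Qed.

(** Markov's inequality: for N > M the mass of [N, +oo[ is at most m_n / N^n <= K (M / N)^n, which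
    tends to 0. *)
Lemma stieltjes_support mu m (K M : R) : 0 < M ->
    stieltjes_represents mu m -> (forall n, m n <= K * M ^+ n) ->
  mu `]M, +oo[%classic = 0%E.
Proof.
move=> M0 [_ mum] mK.
have tail N : M < N -> mu `[N, +oo[%classic = 0%E.
  move=> MN; have N0 : 0 < N by rewrite (lt_trans M0).
  have le n : (mu `[N, +oo[%classic <= (K * (M / N) ^+ n)%:E)%E.
    have : ((N ^+ n)%:E * mu `[N, +oo[%classic <= (K * M ^+ n)%:E)%E.
      rewrite -integral_cst//.
      apply: (@le_trans _ _ (\int[mu]_(x in `[N, +oo[) (x ^+ n)%:E)%E).
        apply: ge0_le_integral => //.
        - by move=> x _; rewrite lee_fin exprn_ge0// ltW.
        - exact: measurable_EFin_exprn.
        - move=> x /=; rewrite in_itv/= andbT => Nx.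
          by rewrite lee_fin lerXn2r// nnegrE ?(ltW N0)// (le_trans (ltW N0)).
      apply: (@le_trans _ _ (m n)%:E); last by rewrite lee_fin.
      rewrite -mum; apply: ge0_subset_integral => //.
      - exact: measurable_EFin_exprn.
      - by move=> x /=; rewrite in_itv/= andbT => ?; rewrite lee_fin exprn_ge0.
      - by apply: subset_itvr; rewrite bnd_simp ltW.
    move=> h; rewrite expr_div_n mulrA [leRHS]EFinM lee_pdivlMr ?exprn_gt0//.
    by rewrite muleC.
  apply/eqP; rewrite eq_le measure_ge0 andbT.
  apply: (@cvge_ge _ \oo _ _ (fun n => (K * (M / N) ^+ n)%:E)); first exact: nearW.
  apply: cvg_EFin; first exact: nearW.
  rewrite -[X in _ --> X](mulr0 K); apply: cvgMr; apply: cvg_expr.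
  by rewrite ger0_norm ?divr_ge0 ?ltW// ltr_pdivrMr// mul1r.
(* The open ray is a countable union of closed rays whose endpoints exceed M. *)
apply/negligibleP => //; rewrite itvoyEbigcup; apply: negligible_bigcup => k.
by apply/negligibleP => //; apply: tail; rewrite ltrDl.
Qed.

Lemma stieltjes_mass mu m : stieltjes_represents mu m ->
  mu `[0%R, +oo[%classic = (m 0%N)%:E.
Proof.
by case=> _ <-; under eq_integral do rewrite expr0; rewrite integral_cst// mul1e.
Qed.

(** Since ]M, +oo[ carries no mass, the moments are integrals over [0, M]; the right side depends on
    [m] alone. *)
Lemma stieltjes_poly mu m (M : R) (p : {poly R}) : 0 < M ->
    stieltjes_represents mu m -> mu `]M, +oo[%classic = 0%E ->
  (\int[mu]_(x in `[0%R, M]) (p.[x])%:E =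
    (\sum_(i < size p) p`_i * m i)%:E)%E.
Proof.
move=> M0 [mu0 mum] muM.
have mom n : (\int[mu]_(x in `[0%R, M]) (x ^+ n)%:E = (m n)%:E)%E.
  rewrite -mum (@itv_bndbnd_setU _ _ (BLeft 0) (BRight M) +oo%O) ?bnd_simp ?(ltW M0)//.
  rewrite ge0_integral_setU//=.
  - rewrite [X in (_ + X)%E]null_set_integral ?adde0//.
    exact: measurable_EFin_exprn.
  - exact: measurable_EFin_exprn.
  - move=> x /=; rewrite !in_itv/= !andbT => -[/andP[]|/ltW] x0; rewrite lee_fin exprn_ge0//.
    by rewrite (le_trans _ x0)// ltW.
  - apply/disj_set2P; apply/seteqP; split => x //=;
    by rewrite !in_itv/= andbT => -[/andP[_]]; rewrite leNgt => /negP.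
have int n : mu.-integrable `[0%R, M] (fun x => (x ^+ n)%:E).
  apply/integrableP; split; first exact: measurable_EFin_exprn.
  under eq_integral => x.
    rewrite inE/= in_itv/= => /andP[x0 _]; rewrite ger0_norm ?exprn_ge0//; over.
  by rewrite mom ltry.
under eq_integral do rewrite horner_coef -sumEFin.
rewrite integral_sum//; last by move=> i; exact: (integrableZl _ p`_i (int i)).
rewrite -sumEFin; apply: eq_bigr => i _.
by under eq_integral do rewrite EFinM; rewrite integralZl// mom.
Qed.

(** Dominated convergence, with dominating function 1, for polynomials tending to the indicator of
    [0, t[. The sums on the left involve the moments only, so they fix the mass of [0, t[. *)
Lemma stieltjes_cdf_cvg mu m (M t : R) : 0 < t <= M ->
    stieltjes_represents mu m -> mu `]M, +oo[%classic = 0%E ->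
  let p n : {poly R} := (1 - (M^-1 *: 'X) ^+ n) ^+ step_exponent (M / t) n in
  ((\sum_(i < size (p n)) (p n)`_i * m i)%:E @[n --> \oo] -->
    mu `[0%R, t[%classic)%E.
Proof.
move=> /andP[t0 tM] hmu muM p.
have M0 : 0 < M by rewrite (lt_le_trans t0).
have pE n x : (p n).[x] = (1 - (x / M) ^+ n) ^+ step_exponent (M / t) n.
  by rewrite /p !hornerE mulrC.
under eq_cvg do rewrite -(stieltjes_poly _ M0 hmu muM).
have -> : mu `[0%R, t[%classic = (\int[mu]_(x in `[0%R, M]) (\1_(`[0%R, t[) x)%:E)%E.
  rewrite integral_indic// setIidl//.
  by apply: subset_itvl; rewrite bnd_simp.
have fin : (mu `[0%R, M]%classic < +oo)%E.
  apply: (@le_lt_trans _ _ (mu `[0%R, +oo[%classic)).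
    by apply: le_measure; rewrite ?inE//; apply: subset_itvl; rewrite bnd_simp.
  by rewrite (stieltjes_mass hmu) ltry.
have Mt1 : 1 <= M / t by rewrite ler_pdivlMr// mul1r.
have [] // := @dominated_convergence _ _ _ mu `[0%R, M] _
  (fun n x => ((p n).[x])%:E) (fun x => (\1_(`[0%R, t[) x)%:E) (cst 1%E).
- move=> n; apply/measurable_EFinP/measurable_funTS.
  by apply: continuous_measurable_fun; exact: continuous_horner.
- by apply/measurable_EFinP; exact: measurable_indic.
- apply: aeW => x /=; rewrite in_itv/= => /andP[x0 xM]; apply: cvg_EFin; first exact: nearW.
  have y0 : 0 <= x / M by rewrite divr_ge0// ltW.
  have y1 : x / M <= 1 by rewrite ler_pdivrMr// mul1r.
  (* With y = x / M and p = M / t, the jump y p = 1 sits at x = t. *)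
  have ypE : x / M * (M / t) = x / t by field; rewrite !gt_eqF.
  under [X in X @ _ --> _]eq_fun do rewrite /= pE.
  rewrite indicE; have [xt|tx] := ltP x t.
    rewrite mem_set/=; last by rewrite in_itv/= x0.
    by apply: cvg_step_lt => //; rewrite ypE ltr_pdivrMr// mul1r.
  rewrite memNset/=; last by rewrite in_itv/= ltNge tx andbF.
  by apply: cvg_step_ge => //; rewrite ypE ler_pdivlMr// mul1r.
- by apply/integrableP; split => //; under eq_integral do rewrite abse1; rewrite integral_cst// mul1e.
- apply: aeW => x n /=; rewrite in_itv/= => /andP[x0 xM]; rewrite lee_fin pE.
  have y0 : 0 <= (x / M) ^+ n by rewrite exprn_ge0// divr_ge0// ltW.
  have y1 : (x / M) ^+ n <= 1 by rewrite exprn_ile1 ?divr_ge0 ?(ltW M0)// ler_pdivrMr// mul1r.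
  by rewrite ger0_norm ?exprn_ge0 ?exprn_ile1 ?subr_ge0 ?gerBl.
Qed.

(** The moments fix the masses of the intervals [0, t[, hence those of the rays ]-oo, t[, which form
    a generating pi-system of the Borel sets. *)
Theorem stieltjes_unique mu nu m (K M : R) :
    (forall n, m n <= K * M ^+ n) ->
    stieltjes_represents mu m -> stieltjes_represents nu m ->
  forall A, measurable A -> mu A = nu A.
Proof.
(* Enlarging the constants to |K| and |M| + 1 keeps the bound and makes the radius positive. *)
wlog M0 : K M / 0 < M.
  move=> wlg mK; apply: (wlg `|K| (`|M| + 1)); first by rewrite ltr_wpDl.
  move=> n; apply: le_trans (mK n) _; apply: le_trans (ler_norm _) _.
  by rewrite normrM normrX ler_wpM2l// lerXn2r ?nnegrE ?addr_ge0// lerDl.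
move=> mK hmu hnu.
have K0 : 0 <= K.
  have := mK 0%N; rewrite expr0 mulr1; apply: le_trans.
  by rewrite -lee_fin -(stieltjes_mass hmu).
have cdf t : 0 < t -> mu `[0%R, t[%classic = nu `[0%R, t[%classic.
  (* The radius is enlarged so that t lies in ]0, N]; the moment bound survives because K >= 0. *)
  move=> t0; pose N := Num.max M t.
  have N0 : 0 < N by rewrite lt_max M0.
  have tN : 0 < t <= N by rewrite t0 le_max lexx orbT.
  have mN n : m n <= K * N ^+ n.
    apply: le_trans (mK n) _; rewrite ler_wpM2l// lerXn2r ?nnegrE ?(ltW M0) ?(ltW N0)//.
    by rewrite le_max lexx.
  have := stieltjes_cdf_cvg tN hmu (stieltjes_support N0 hmu mN).
  have := stieltjes_cdf_cvg tN hnu (stieltjes_support N0 hnu mN).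
  by move=> /= h1 h2; apply: cvg_unique h2 h1.
have ray t : mu `]-oo, t[%classic = nu `]-oo, t[%classic.
  have [t0|t0] := leP t 0.
    have null (la : {measure set (measurableTypeR R) -> \bar R}) :
        stieltjes_represents la m -> la `]-oo, t[%classic = 0%E.
      move=> [la0 _]; apply/eqP; rewrite eq_le measure_ge0 andbT -la0.
      by apply: le_measure; rewrite ?inE//; apply: subset_itvl; rewrite bnd_simp.
    by rewrite !null.
  rewrite (@itv_bndbnd_setU _ _ -oo%O (BLeft 0) (BLeft t)) ?bnd_simp ?(ltW t0)//.
  have dis : `]-oo, 0%R[%classic `&` `[0%R, t[%classic = set0 :> set R.
    by apply/seteqP; split => x //=; rewrite !in_itv/= => -[x0 /andP[]]; rewrite leNgt x0.
  have mE (la : {measure set (measurableTypeR R) -> \bar R}) :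
      la (`]-oo, 0%R[%classic `|` `[0%R, t[%classic) =
      (la `]-oo, 0%R[%classic + la `[0%R, t[%classic)%E.
    exact: measureU.
  by rewrite !mE hmu.1 hnu.1 cdf.
(* Uniqueness on a pi-system asks for an exhaustion by generators of finite mass. *)
have finG k : (mu `]-oo, k%:R[%classic < +oo)%E.
  apply: (@le_lt_trans _ _ (mu (`]-oo, 0%R[%classic `|` `[0%R, +oo[%classic))).
    apply: le_measure; rewrite ?inE//; first exact: measurableU.
    by move=> x _ /=; rewrite !in_itv/= andbT; case: ltP; [left|right].
  apply: (@le_lt_trans _ _ (mu `]-oo, 0%R[%classic + mu `[0%R, +oo[%classic)%E).
    exact: measureU2.
  by rewrite hmu.1 add0e (stieltjes_mass hmu) ltry.
move=> A mA; apply: (@measure_unique _ R (measurableTypeR R) (@RGenInftyO.G R)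
  (fun k => `]-oo, k%:R[%classic)) mA => //.
- exact: RGenInftyO.measurableE.
- move=> _ _ [x ->] [y ->]; exists (Num.min x y).
  by apply/seteqP; split => z /=; rewrite !in_itv/= lt_min => /andP.
- by move=> i; exists i%:R.
- apply/seteqP; split => x // _; exists (Num.truncn x).+1 => //=.
  by rewrite in_itv/= truncnS_gt.
- by move=> _ [x ->]; exact: ray.
Qed.

End bounded_moments.

(** * Measures given by a density, and image measures *)

Section measure_with_density.
Context d (T : measurableType d) (R : realType).
Variables (mu : {measure set T -> \bar R}) (D : set T) (f : T -> R).
Hypotheses (mD : measurable D) (mf : measurable_fun D f).
Hypothesis f0 : forall x, D x -> 0 <= f x.

Import HBNNSimple.

Let density A := (\int[mu]_(x in A `&` D) (f x)%:E)%E.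

Let density0 : density set0 = 0%E.
Proof. by rewrite /density set0I integral_set0. Qed.

Let density_ge0 A : (0 <= density A)%E.
Proof. by apply: integral_ge0 => x [_ Dx]; rewrite lee_fin f0. Qed.

Let density_sigma_additive : semi_sigma_additive density.
Proof.
move=> /= F mF tF mUF; rewrite /density setI_bigcupl; apply: cvg_toP.
  apply: ereal_nondecreasing_is_cvgn => m n mn.
  by apply: lee_sum_nneg_natr => // k _ _; exact: density_ge0.
rewrite ge0_integral_bigcup//=.
- by move=> k; exact: measurableI.
- apply/measurable_EFinP; apply: measurable_funS mf => //.
  by apply: bigcup_sub => k _; exact: subIsetr.
- by move=> x [k _ [_ Dx]]; rewrite lee_fin f0.
- exact: trivIset_setIr.
Qed.

(** The integration formula holds for indicators by construction, for simple functions by finite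
    sums, and for nonnegative [g] by monotone convergence along simple approximations. *)
Lemma density_measure_exists : exists nu : {measure set T -> \bar R},
  (forall A, measurable A -> nu A = \int[mu]_(x in A `&` D) (f x)%:E)%E /\
  (forall E g, measurable E -> measurable_fun E g ->
    (forall x, E x -> (0 <= g x)%E) ->
    (\int[nu]_(x in E) g x = \int[mu]_(x in E `&` D) (g x * (f x)%:E))%E).
Proof.
pose nu : {measure set T -> \bar R} := HB.pack density
  (isMeasure.Build _ _ _ density density0 density_ge0 density_sigma_additive).
exists nu; split => // E g mE mg g0.
have mED : measurable (E `&` D) by exact: measurableI.
have mfED : measurable_fun (E `&` D) (EFin \o f).
  by apply/measurable_EFinP; exact: measurable_funS mf.
pose h := nnsfun_approx mE mg.
transitivity (limn (fun n => \int[nu]_(x in E) (h n x)%:E)%E).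
  rewrite -monotone_convergence//.
  - apply: eq_integral => y /[!inE] yE; apply/esym/cvg_lim => //.
    exact: cvg_nnsfun_approx.
  - by move=> n; exact/measurable_EFinP/measurable_funTS.
  - by move=> n y _; rewrite lee_fin.
  - by move=> y _ m n mn; rewrite lee_fin; exact/lefP/nd_nnsfun_approx.
transitivity (limn (fun n => \int[mu]_(x in E `&` D) ((h n x)%:E * (f x)%:E))%E); last first.
  rewrite -monotone_convergence//.
  - apply: eq_integral => y /[!inE] -[yE yD]; apply/cvg_lim => //.
    by apply: cvgeZr => //; exact: cvg_nnsfun_approx.
  - by move=> n; apply: emeasurable_funM => //; exact/measurable_EFinP/measurable_funTS.
  - by move=> n y [_ yD]; rewrite mule_ge0 ?lee_fin ?f0.
  - move=> y [_ yD] m n mn; rewrite lee_wpmul2r ?lee_fin ?f0//.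
    exact/lefP/nd_nnsfun_approx.
congr (limn _); apply/funext => n.
have mh r : measurable (h n @^-1` [set r]) by exact: measurable_sfunP.
transitivity (\sum_(r \in range (h n))
    (r%:E * \int[mu]_(x in E `&` D) ((\1_(h n @^-1` [set r]) x)%:E * (f x)%:E))%E)%R.
  under eq_integral do rewrite fimfunE -fsumEFin//.
  rewrite ge0_integral_fsum//; last 2 first.
  - by move=> r; apply/measurable_EFinP/measurable_funTS/measurable_funM.
  - by move=> r x _; rewrite nnfun_muleindic_ge0.
  apply: eq_fsbigr => r _; rewrite integralZl_indic_nnsfun// integral_indic//=.
  rewrite /density; congr (_ * _)%E.
  rewrite -setIA integral_mkcondl; apply: eq_integral => x _.
  by rewrite patchE indicE; case: ifPn => _; rewrite ?mul1e ?mul0e.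
under [RHS]eq_integral do rewrite fimfunE -fsumEFin//.
under [RHS]eq_integral => x xED.
  rewrite ge0_mule_fsuml; last by move=> r; exact: nnfun_muleindic_ge0.
  over.
rewrite ge0_integral_fsum//; last 2 first.
- move=> r; apply: emeasurable_funM => //.
  by apply/measurable_EFinP/measurable_funTS/measurable_funM.
- by move=> r x [_ xD]; rewrite mule_ge0 ?lee_fin ?f0// -?lee_fin ?nnfun_muleindic_ge0.
apply: eq_fsbigr => r /[!inE] -[z _ <-].
under [RHS]eq_integral do rewrite EFinM -muleA.
rewrite ge0_integralZl_EFin//.
- by move=> x [_ xD]; rewrite mule_ge0 ?lee_fin ?f0.
- by apply: emeasurable_funM => //; apply/measurable_EFinP/measurable_funTS.
Qed.

End measure_with_density.

(** Packages the image measure with its change of variables formula, so that later constructions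
    rest on these two facts. *)
Lemma pushforward_exists d1 d2 (T1 : measurableType d1) (T2 : measurableType d2)
    (R : realType) (mu : {measure set T1 -> \bar R}) (phi : T1 -> T2) :
    measurable_fun setT phi -> exists nu : {measure set T2 -> \bar R},
  (forall A, nu A = mu (phi @^-1` A)) /\
  (forall E g, measurable E -> measurable_fun E g ->
    (forall y, E y -> (0 <= g y)%E) ->
    (\int[nu]_(y in E) g y = \int[mu]_(x in phi @^-1` E) g (phi x))%E).
Proof.
move=> mphi.
unshelve refine (ex_intro _ (pushforward mu phi : {measure set T2 -> \bar R}) _).
  exact: mphi.
split => // E g mE mg g0.
by rewrite (ge0_integral_pushforward mphi)// => y /[!inE]; exact: g0.
Qed.

(** * Affine substitution in Lebesgue integrals *)

Section affine_change_of_variable.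
Context {R : realType}.
Local Notation leb := (@lebesgue_measure R).

(** The image of Lebesgue measure under x -> a x + b, multiplied by a, gives each interval ]c, e]
    its length, so it is Lebesgue measure. *)
Lemma ge0_integral_affine (a b : R) (f : R -> \bar R) : 0 < a ->
    measurable_fun setT f -> (forall x, (0 <= f x)%E) ->
  (\int[leb]_x f x = a%:E * \int[leb]_x f (a * x + b)%R)%E.
Proof.
move=> a0 mf f0.
pose phi : measurableTypeR R -> measurableTypeR R := fun x => a * x + b.
have mphi : measurable_fun setT phi.
  by apply: measurable_funD => //; exact: mulrl_measurable.
have [nu [nuE nu_int]] := pushforward_exists leb mphi.
pose ap : {nonneg R} := NngNum (ltW a0).
transitivity (\int[mscale ap nu]_x f x)%E.
  apply: eq_measure_integral => A mA _.
  apply: (@lebesgue_measure_unique R (mscale ap nu)) mA => _ [[c e] _ <-].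
  rewrite /= /mscale/= nuE.
  rewrite (_ : phi @^-1` _ = `](c - b) / a, (e - b) / a]%classic); last first.
    by apply/seteqP; split => x /=;
      rewrite !in_itv/= /phi ltr_pdivrMr// ler_pdivlMr// ltrBlDr lerBrDr (mulrC x).
  have lebE (u v : R) : leb `]u, v]%classic = (if (u < v)%R then (v - u)%:E else 0%E).
    by rewrite lebesgue_measure_itv/= lte_fin.
  rewrite [LHS]lebE [X in (_ * X)%E]lebE ltr_pM2r ?invr_gt0// ltrD2r.
  case: ifPn => ce; last by rewrite mule0.
  by rewrite -EFinM; congr EFin; field; rewrite gt_eqF.
by rewrite ge0_integral_mscale// nu_int// preimage_setT.
Qed.

End affine_change_of_variable.

(* No condition on the support of [mu] is needed: the law of [4^c exp(-X)] sits
   on [0, +oo[ anyway. *)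
Definition laplace_transform (R : realType) (f : R -> R) : Prop :=
  exists mu : {measure set (measurableTypeR R) -> \bar R},
    forall s, 0 <= s -> (\int[mu]_x (expR (- (s * x)))%:E = (f s)%:E)%E.

(** * Closure properties of Laplace transforms of measures *)

Section laplace_transforms.
Context {R : realType}.
Implicit Types f g : R -> R.
Local Notation MR := (measurableTypeR R).

Lemma measurable_expR_NM (s : R) : measurable_fun setT (fun x : MR => (expR (- (s * x)))%:E).
Proof.
apply/measurable_EFinP; apply: measurableT_comp => //.
by apply: measurableT_comp => //; exact: mulrl_measurable.
Qed.

Lemma laplace_ge0 f (s : R) : laplace_transform f -> 0 <= s -> 0 <= f s.
Proof.
move=> [mu h] s0; rewrite -lee_fin -h//.
by apply: integral_ge0 => x _; rewrite lee_fin expR_ge0.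
Qed.

(** The value at s = 0 is the total mass, hence finite. Repackaging as a finite measure gives access
    to product measures and Tonelli. *)
Lemma laplace_finite f : laplace_transform f ->
  exists mu : {finite_measure set MR -> \bar R},
    forall s, 0 <= s -> (\int[mu]_x (expR (- (s * x)))%:E = (f s)%:E)%E.
Proof.
move=> [mu h].
have fin : (mu setT < +oo)%E.
  have := h 0 (lexx _); under eq_integral do rewrite mul0r oppr0 expR0.
  by rewrite integral_cst// mul1e => ->; rewrite ltry.
exists (mfrestr measurableT fin) => s s0; rewrite -h//.
by apply: eq_measure_integral => A mA _; rewrite /= /mfrestr /mrestr setIT.
Qed.

Lemma eq_laplace f g : (forall s, 0 <= s -> f s = g s) ->
  laplace_transform f -> laplace_transform g.
Proof. by move=> fg [mu h]; exists mu => s s0; rewrite h// fg. Qed.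

Lemma laplace1 : laplace_transform (fun=> 1 : R).
Proof.
exists (\d_(0%R : MR)) => s s0; rewrite integral_dirac//=.
  by rewrite diracT mul1e mulr0 oppr0 expR0.
exact: measurable_expR_NM.
Qed.

Lemma laplaceZ (k : R) f : 0 <= k -> laplace_transform f ->
  laplace_transform (fun s => k * f s).
Proof.
move=> k0 [mu h]; exists (mscale (NngNum k0) mu) => s s0.
rewrite ge0_integral_mscale//=.
- by rewrite h.
- exact: measurable_expR_NM.
Qed.

(** Convolution: the representing measure is the image of the product measure under addition. *)
Lemma laplaceM f g : laplace_transform f -> laplace_transform g ->
  laplace_transform (fun s => f s * g s).
Proof.
move=> lf lg.
have [mu hmu] := laplace_finite lf; have [nu hnu] := laplace_finite lg.
have madd : measurable_fun setT (fun z : MR * MR => z.1 + z.2 : MR).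
  by apply: measurable_funD; [exact: measurable_fst|exact: measurable_snd].
have [la [_ la_int]] := pushforward_exists (mu \x nu)%E madd.
exists la => s s0; rewrite la_int//; last exact: measurable_expR_NM.
rewrite preimage_setT.
rewrite (fubini_tonelli1 (fun z : MR * MR => (expR (- (s * (z.1 + z.2))))%:E)); last 2 first.
- exact: (measurableT_comp (measurable_expR_NM s) madd).
- by move=> z; rewrite lee_fin expR_ge0.
rewrite /fubini_F/=.
under eq_integral => x _.
  under eq_integral do rewrite mulrDr opprD expRD EFinM.
  rewrite ge0_integralZl_EFin ?expR_ge0//; last exact: measurable_expR_NM.
  rewrite hnu// muleC; over.
rewrite ge0_integralZl_EFin//; last by exact: laplace_ge0.
  by rewrite hmu// muleC.
exact: measurable_expR_NM.
Qed.

Lemma laplaceX f n : laplace_transform f -> laplace_transform (fun s => f s ^+ n).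
Proof.
move=> lf; elim: n => [|n ih]; first exact: laplace1.
by apply: eq_laplace (laplaceM lf ih) => s _; rewrite exprS.
Qed.

(** The representing measure is the sum of those of the terms; a nonnegative function integrates
    against a series of measures term by term. *)
Lemma laplace_series (F : nat -> R -> R) f : (forall n, laplace_transform (F n)) ->
    (forall s, 0 <= s -> series (F ^~ s) @ \oo --> f s) ->
  laplace_transform f.
Proof.
move=> lF Ff; pose m n := projT1 (cid (lF n)).
have mE n s : 0 <= s -> (\int[m n]_x (expR (- (s * x)))%:E = (F n s)%:E)%E.
  by move=> s0; rewrite /m; case: cid => /= mu; exact.
exists (mseries m 0) => s s0.
rewrite ge0_integral_measure_series//; last exact: measurable_expR_NM.
apply/cvg_lim => //.
under eq_cvg => n.
  rewrite (eq_bigr (fun k => (F k s)%:E)); last by move=> k _; rewrite mE.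
  rewrite sumEFin; over.
by apply: cvg_EFin; [exact: nearW|exact: Ff].
Qed.

(** The compound Poisson construction: the exponential series has nonnegative coefficients 1 / n!,
    and its powers are convolution powers. *)
Lemma laplace_expR f : laplace_transform f -> laplace_transform (fun s => expR (f s)).
Proof.
move=> lf; apply: (@laplace_series (fun n s => n`!%:R^-1 * f s ^+ n)).
- by move=> n; apply: laplaceZ; [rewrite invr_ge0|exact: laplaceX].
- move=> s s0; have := @is_cvg_series_exp_coeff R (f s).
  rewrite /expR; apply: cvg_trans; apply: near_eq_cvg; near=> n.
  by rewrite /series/=; apply: eq_bigr => k _; rewrite /exp_coeff/= mulrC.
Unshelve. all: by end_near.
Qed.

End laplace_transforms.

(** The inverse is f times the power (f^2)^(-1); where f = 0 both sides are 0, by the convention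
    that 0 has inverse 0. *)
Lemma measurable_funV d (T : measurableType d) (R : realType) (D : set T) (f : T -> R) :
  measurable_fun D f -> measurable_fun D (fun x => (f x)^-1).
Proof.
move=> mf; rewrite (_ : (fun x => _) = fun x => f x * (f x ^+ 2) `^ (-1)).
  apply: measurable_funM => //; apply: (measurableT_comp (measurable_powR _)).
  exact: measurable_funX.
apply/funext => x; rewrite powR_inv1 ?sqr_ge0//.
have [->|fx0] := eqVneq (f x) 0; first by rewrite mul0r invr0.
by rewrite expr2 invfM mulrA divff// mul1r.
Qed.

(** * Integrals of derivatives, and of powers on the unit interval *)

Section elementary_integrals.
Context {R : realType}.
Local Notation leb := (@lebesgue_measure R).

Lemma integral_is_derive (f F : R -> R) (a b : R) : a < b ->
    (forall x, a <= x <= b -> is_derive x 1 F (f x)) ->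
    (forall x, a <= x <= b -> {for x, continuous f}) ->
  (\int[leb]_(x in `[a, b]) (f x)%:E = (F b - F a)%:E)%E.
Proof.
move=> ab dF cf.
have cF x : a <= x <= b -> {for x, continuous F}.
  move=> /dF d; apply: differentiable_continuous; apply/derivable1_diffP.
  exact: ex_derive.
rewrite (@continuous_FTC2 _ f F)//.
- apply: continuous_in_subspaceT => x; rewrite inE/= in_itv/=; exact: cf.
- split.
  + move=> x; rewrite in_itv/= => /andP[/ltW ax /ltW xb].
    by have := dF x; rewrite ax xb => /(_ isT) d; exact: ex_derive.
  + by apply: cvg_at_right_filter; apply: cF; rewrite lexx ltW.
  + by apply: cvg_at_left_filter; apply: cF; rewrite lexx ltW.
- move=> x; rewrite in_itv/= => /andP[/ltW ax /ltW xb].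
  have := dF x; rewrite ax xb => /(_ isT) d.
  by rewrite derive1E; exact: derive_val.
Qed.

Lemma continuous_powRl (p x : R) : 0 < x -> {for x, continuous (fun y : R => y `^ p)}.
Proof.
move=> x0; apply: differentiable_continuous; apply/derivable1_diffP.
by apply: derivable_powR; rewrite in_itv/= x0.
Qed.

(** For p < 0 the integrand is unbounded at 0, so ]0, 1] is exhausted by the intervals
    [1 / (n + 1), 1], where a primitive is available. *)
Lemma integral_powR01 (p : R) : -1 < p ->
  (\int[leb]_(x in `]0%R, 1%R[) (x `^ p)%:E = ((p + 1)^-1)%:E)%E.
Proof.
move=> p1; have p0 : 0 < p + 1 by rewrite -ltrBlDr sub0r.
have mp (D : set R) : measurable_fun D (fun x : R => (x `^ p)%:E).
  by apply/measurable_EFinP; apply: measurable_funTS; exact: measurable_powR.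
rewrite integral_itv_bndo_bndc//.
pose S (n : nat) : set R := `[n.+1%:R^-1, 1]%classic.
have US : `]0, 1]%classic = \bigcup_n S n.
  apply/seteqP; split => x /=.
    rewrite in_itv/= => /andP[x0 x1]; exists (Num.truncn x^-1) => //=.
    rewrite /S/= in_itv/= x1 andbT -[leRHS]invrK lef_pV2 ?posrE ?invr_gt0//.
    by rewrite ltW// truncnS_gt.
  move=> [n _]; rewrite /S/= !in_itv/= => /andP[nx ->]; rewrite andbT.
  by rewrite (lt_le_trans _ nx).
rewrite US.
have /cvg_lim <- // : (\int[leb]_(x in S n) (x `^ p)%:E @[n --> \oo] -->
    \int[leb]_(x in \bigcup_n S n) (x `^ p)%:E)%E.
  apply: ge0_nondecreasing_set_cvg_integral => //.
  - move=> m n mn; rewrite subsetEset; apply: subset_itvr.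
    by rewrite bnd_simp lef_pV2 ?posrE// ler_nat.
  - by move=> i; exact: measurable_itv.
  - by move=> i; exact: mp.
  - by move=> i x _; rewrite lee_fin powR_ge0.
apply/cvg_lim => //; apply: (@cvg_trans _ (((p + 1)^-1 - (p + 1)^-1 * n.+1%:R^-1 `^ (p + 1))%:E @[n --> \oo])%E).
  apply: near_eq_cvg; near=> n.
  (* For n = 0 the interval degenerates to the point 1; n is taken large to have distinct
     endpoints. *)
  have n1 : n.+1%:R^-1 < 1 :> R.
    by rewrite invf_lt1// ltr1n ltnS; near: n; exact: nbhs_infty_gt.
  have pos (x : R) : n.+1%:R^-1 <= x <= 1 -> 0 < x by move=> /andP[/(lt_le_trans _)->].
  have dF (x : R) : n.+1%:R^-1 <= x <= 1 ->
      is_derive x 1 (fun y : R => (p + 1)^-1 * y `^ (p + 1)) (x `^ p).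
    move=> /pos x0.
    have -> : x `^ p = (p + 1)^-1 *: ((p + 1) * x `^ (p + 1 - 1)).
      by rewrite addrK /GRing.scale/= mulKf// gt_eqF.
    by apply: is_deriveZ; exact: is_derive1_powR.
  have cf (x : R) : n.+1%:R^-1 <= x <= 1 -> {for x, continuous (fun y : R => y `^ p)}.
    by move=> /pos; exact: continuous_powRl.
  by rewrite /S (integral_is_derive n1 dF cf) powR1 mulr1.
apply: cvg_EFin; first exact: nearW.
rewrite -[X in _ --> X]subr0 -[X in _ - X](mulr0 (p + 1)^-1).
apply: cvgB; first exact: cvg_cst.
apply: cvgMr; have /cvg_at_rightP/(_ (fun n => n.+1%:R^-1)) := powR_cvg0 p0.
by apply; split => //; exact: cvg_harmonic.
Unshelve. all: by end_near.
Qed.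

End elementary_integrals.

(** * Euler's Gamma and Beta integrals *)

Section gamma_and_beta_integrals.
Context {R : realType}.
Local Notation leb := (@lebesgue_measure R).
Implicit Types a b x z : R.

(** Extended by 0 to the whole line, so that translations, dilations and convolutions are integrals
    over the line. *)
Definition gamma_integrand a x : R := x `^ (a - 1) * expR (- x) * \1_`]0%R, +oo[ x.

Definition beta_integrand a b x : R :=
  x `^ (a - 1) * (1 - x) `^ (b - 1) * \1_`]0%R, 1%R[ x.

(** Extended-real valued, so that Tonelli applies before finiteness is known; [gamma_integralE]
    links it to [Gamma]. *)
Definition gamma_integral a : \bar R := (\int[leb]_x (gamma_integrand a x)%:E)%E.

Definition beta_integral a b : \bar R := (\int[leb]_x (beta_integrand a b x)%:E)%E.

Lemma gamma_integrand_ge0 a x : 0 <= gamma_integrand a x.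
Proof. by rewrite !mulr_ge0 ?powR_ge0 ?expR_ge0. Qed.

Lemma beta_integrand_ge0 a b x : 0 <= beta_integrand a b x.
Proof. by rewrite !mulr_ge0 ?powR_ge0. Qed.

Lemma gamma_integrand_gt0E a x : 0 < x -> gamma_integrand a x = x `^ (a - 1) * expR (- x).
Proof. by move=> x0; rewrite /gamma_integrand indicE mem_set ?mulr1//= in_itv/= x0. Qed.

Lemma gamma_integrand_le0E a x : x <= 0 -> gamma_integrand a x = 0.
Proof.
move=> x0; rewrite /gamma_integrand indicE memNset ?mulr0//=.
by rewrite in_itv/= andbT ltNge x0.
Qed.

Lemma beta_integrandE a b x : 0 < x < 1 ->
  beta_integrand a b x = x `^ (a - 1) * (1 - x) `^ (b - 1).
Proof. by move=> x01; rewrite /beta_integrand indicE mem_set ?mulr1. Qed.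

Lemma beta_integrandN a b x : ~~ (0 < x < 1) -> beta_integrand a b x = 0.
Proof.
by move=> x01; rewrite /beta_integrand indicE memNset ?mulr0//=; exact/negP.
Qed.

Lemma measurable_gamma_integrand a : measurable_fun setT (gamma_integrand a).
Proof.
apply: measurable_funM; last exact: measurable_indic.
apply: measurable_funM; first exact: measurable_powR.
by apply: measurableT_comp => //; exact: measurableT_comp.
Qed.

Lemma measurable_beta_integrand a b : measurable_fun setT (beta_integrand a b).
Proof.
apply: measurable_funM; last exact: measurable_indic.
apply: measurable_funM; first exact: measurable_powR.
by apply: (measurableT_comp (measurable_powR _)); exact: measurable_funB.
Qed.

Lemma gamma_integral_ge0 a : (0 <= gamma_integral a)%E.
Proof. by apply: integral_ge0 => x _; rewrite lee_fin gamma_integrand_ge0. Qed.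

Lemma beta_integral_ge0 a b : (0 <= beta_integral a b)%E.
Proof. by apply: integral_ge0 => x _; rewrite lee_fin beta_integrand_ge0. Qed.

Lemma gamma_integral_itv a : gamma_integral a =
  (\int[leb]_(x in `]0%R, +oo[) (x `^ (a - 1) * expR (- x))%:E)%E.
Proof.
rewrite [RHS]integral_mkcond; apply: eq_integral => x _.
rewrite patchE; case: ifPn => [/set_mem|/negP x0] /=.
  by rewrite in_itv/= andbT => x0; rewrite gamma_integrand_gt0E.
rewrite gamma_integrand_le0E// leNgt; apply/negP => xp.
by apply: x0; rewrite inE/= in_itv/= xp.
Qed.

Lemma beta_integral_itv a b : beta_integral a b =
  (\int[leb]_(x in `]0%R, 1%R[) (x `^ (a - 1) * (1 - x) `^ (b - 1))%:E)%E.
Proof.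
rewrite [RHS]integral_mkcond; apply: eq_integral => x _.
rewrite patchE; case: ifPn => [/set_mem|x0] /=.
  by rewrite in_itv/= => x01; rewrite beta_integrandE.
by rewrite beta_integrandN//; move: x0; rewrite notin_setE/= in_itv/= => /negP.
Qed.

(** For z > 0 the dilation x -> z x extracts z^(1 + (a - 1) + (b - 1)), and the two exponentials
    multiply to exp(-z). For z <= 0 both sides vanish. *)
Lemma gamma_integrand_convolution a b z :
  (\int[leb]_x (gamma_integrand a x * gamma_integrand b (z - x))%:E =
   (gamma_integrand (a + b) z)%:E * beta_integral a b)%E.
Proof.
have [z0|z0] := leP z 0.
  rewrite gamma_integrand_le0E// mul0e integral0_eq// => x _.
  have [x0|x0] := leP x 0; first by rewrite gamma_integrand_le0E ?mul0r.
  by rewrite (@gamma_integrand_le0E b) ?mulr0// subr_le0 (le_trans z0)// ltW.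
have mg : measurable_fun setT
    (fun x => (gamma_integrand a x * gamma_integrand b (z - x))%:E).
  apply/measurable_EFinP; apply: measurable_funM; first exact: measurable_gamma_integrand.
  by apply: (measurableT_comp (measurable_gamma_integrand _)); exact: measurable_funB.
rewrite (@ge0_integral_affine _ z 0)//; last first.
  by move=> x; rewrite lee_fin mulr_ge0// gamma_integrand_ge0.
rewrite -[in RHS]ge0_integralZl_EFin ?gamma_integrand_ge0//; last 2 first.
- by move=> x _; rewrite lee_fin beta_integrand_ge0.
- by apply/measurable_EFinP; exact: measurable_beta_integrand.
rewrite -ge0_integralZl_EFin ?(ltW z0)//; last 2 first.
- by move=> x _; rewrite lee_fin mulr_ge0// gamma_integrand_ge0.
- apply: (measurableT_comp mg); apply: measurable_funD => //; exact: mulrl_measurable.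
apply: eq_integral => x _; rewrite -!EFinM addr0; congr EFin.
have [/andP[x0 x1]|x01] := boolP (0 < x < 1); last first.
  rewrite beta_integrandN// mulr0; have [xle0|xgt0] := leP x 0.
    by rewrite gamma_integrand_le0E ?mul0r ?mulr0// pmulr_rle0.
  rewrite (@gamma_integrand_le0E b) ?mulr0//.
  move: x01; rewrite xgt0/= -leNgt => x1.
  by rewrite subr_le0 ler_peMr// ltW.
have x1' : 0 < 1 - x by rewrite subr_gt0.
have -> : z - z * x = z * (1 - x) by ring.
rewrite !gamma_integrand_gt0E ?mulr_gt0// beta_integrandE ?x0//.
rewrite !powRM ?(ltW z0) ?(ltW x0) ?(ltW x1')//.
have -> : a + b - 1 = 1 + ((a - 1) + (b - 1)) by ring.
rewrite (@powRD _ z 1) ?(gt_eqF z0) ?implybT// (@powRD _ z (a - 1)) ?(gt_eqF z0) ?implybT//.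
rewrite powRr1 ?(ltW z0)//.
have -> : expR (- z) = expR (- (z * x)) * expR (- (z * (1 - x))).
  by rewrite -expRD; congr expR; ring.
by ring.
Qed.

(** By Tonelli, the product of the integrals of two functions is the integral of their
    convolution. *)
Lemma gamma_beta a b :
  (gamma_integral a * gamma_integral b = gamma_integral (a + b) * beta_integral a b)%E.
Proof.
have mg c : measurable_fun setT (fun x => (gamma_integrand c x)%:E).
  by apply/measurable_EFinP; exact: measurable_gamma_integrand.
have g0 c x : (0 <= (gamma_integrand c x)%:E)%E by rewrite lee_fin gamma_integrand_ge0.
rewrite {1}/gamma_integral -ge0_integralZr ?gamma_integral_ge0//; last exact: mg.
transitivity (\int[leb]_x \int[leb]_z (gamma_integrand a x * gamma_integrand b (z - x))%:E)%E.
  apply: eq_integral => x _.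
  under eq_integral do rewrite EFinM.
  rewrite ge0_integralZl_EFin ?gamma_integrand_ge0//; last first.
    apply/measurable_EFinP; apply: (measurableT_comp (measurable_gamma_integrand _)).
    exact: measurable_funB.
  congr (_ * _)%E; rewrite /gamma_integral (@ge0_integral_affine _ 1 (- x))// mul1e.
  by apply: eq_integral => z _; rewrite mul1r.
rewrite (@fubini_tonelli _ _ _ _ _ leb leb
    (fun w => (gamma_integrand a w.1 * gamma_integrand b (w.2 - w.1))%:E))/=; last 2 first.
- apply/measurable_EFinP; apply: measurable_funM.
    exact: (measurableT_comp (measurable_gamma_integrand _) measurable_fst).
  apply: (measurableT_comp (measurable_gamma_integrand _)).
  by apply: measurable_funB; [exact: measurable_snd|exact: measurable_fst].
- by move=> w; rewrite lee_fin mulr_ge0// gamma_integrand_ge0.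
under eq_integral do rewrite gamma_integrand_convolution.
by rewrite ge0_integralZr ?beta_integral_ge0//; exact: mg.
Qed.

Lemma beta_integral1 a : 0 < a -> beta_integral a 1 = (a^-1)%:E.
Proof.
move=> a0; rewrite beta_integral_itv.
under eq_integral do rewrite subrr powRr0 mulr1.
by rewrite integral_powR01 ?subrK// ltrBrDr addNr.
Qed.

Lemma gamma_integral1 : gamma_integral 1 = 1%E.
Proof.
rewrite gamma_integral_itv.
under eq_integral do rewrite subrr powRr0 mul1r.
rewrite integral_itv_obnd_cbnd; last first.
  by apply/measurable_EFinP; apply: measurableT_comp => //; exact: measurable_funN.
rewrite -(@integral_exponential_pdf R 1)// [LHS]integral_mkcond.
apply: eq_integral => x _; rewrite /exponential_pdf !patchE.
by case: ifPn => // _; rewrite mul1r mulN1r.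
Qed.

(** The values Gamma(1) = 1 and B(a, 1) = 1 / a in the Gamma-Beta relation take the place of
    integration by parts. *)
Lemma gamma_integralS a : 0 < a -> gamma_integral (a + 1) = (a%:E * gamma_integral a)%E.
Proof.
move=> a0; have := gamma_beta a 1; rewrite gamma_integral1 mule1 beta_integral1// => ->.
by rewrite muleC -muleA -EFinM mulVf ?mule1// gt_eqF.
Qed.

(** The recurrence settles positive integers. With n the integer part of a, x^a <= 1 + x^(n + 1)
    bounds the integral at a + 1, and the recurrence leads back to a. *)
Lemma gamma_integral_lty a : 0 < a -> (gamma_integral a < +oo)%E.
Proof.
move=> a0.
have nat_lty n : (gamma_integral n.+1%:R < +oo)%E.
  elim: n => [|n ih]; first by rewrite gamma_integral1 ltry.
  by rewrite -natr1 gamma_integralS// lte_mul_pinfty.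
have : (gamma_integral (a + 1) < +oo)%E.
  pose n := Num.truncn a.
  apply: (@le_lt_trans _ _ (gamma_integral 1 + gamma_integral n.+2%:R)%E); last first.
    by rewrite lte_add_pinfty// gamma_integral1 ltry.
  have mg c : measurable_fun setT (fun x => (gamma_integrand c x)%:E).
    by apply/measurable_EFinP; exact: measurable_gamma_integrand.
  have g0 c x : (0 <= (gamma_integrand c x)%:E)%E by rewrite lee_fin gamma_integrand_ge0.
  rewrite -ge0_integralD//; [|exact: mg|exact: mg].
  apply: ge0_le_integral => //; [exact: mg|by apply: emeasurable_funD; exact: mg|].
  move=> x _; rewrite -EFinD lee_fin.
  have [x0|x0] := leP x 0; first by rewrite !gamma_integrand_le0E// addr0.
  rewrite !gamma_integrand_gt0E// -mulrDl ler_wpM2r ?expR_ge0//.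
  rewrite addrK subrr powRr0 -[n.+2%:R]natr1 addrK.
  have [x1|x1] := leP x 1.
    apply: (@le_trans _ _ 1); last by rewrite lerDl powR_ge0.
    have -> : 1 = 1 `^ a by rewrite powR1.
    by apply: ge0_ler_powR; rewrite ?nnegrE// ltW.
  apply: (@le_trans _ _ (x `^ n.+1%:R)); last by rewrite lerDr.
  by apply: ler_powR; [exact: ltW|rewrite ltW// truncnS_gt].
rewrite gamma_integralS// !ltey; apply: contra => /eqP ->.
by rewrite gt0_muley ?lte_fin.
Qed.

Lemma gamma_integralE a : 0 < a -> gamma_integral a = (Gamma a)%:E.
Proof.
move=> a0; rewrite /Gamma /Rintegral -gamma_integral_itv fineK//.
by rewrite ge0_fin_numE ?gamma_integral_ge0// gamma_integral_lty.
Qed.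

(** On [1, 2] the integrand is at least exp(-2) / 2, because x^(a - 1) >= 1 / x >= 1 / 2 there. *)
Lemma Gamma_gt0 a : 0 < a -> 0 < Gamma a.
Proof.
move=> a0; rewrite -lte_fin -gamma_integralE//.
apply: (@lt_le_trans _ _ (expR (- 2) / 2)%:E); first by rewrite lte_fin divr_gt0 ?expR_gt0.
have -> : ((expR (- 2) / 2)%:E = \int[leb]_(x in `[1%R, 2%R]) cst (expR (- 2) / 2 : R)%:E x)%E.
  rewrite integral_cst//= lebesgue_measure_itv/= lte_fin ltr1n/= -EFinD.
  by rewrite -EFinM; congr EFin; ring.
apply: (@le_trans _ _ (\int[leb]_(x in `[1%R, 2%R]) (gamma_integrand a x)%:E)%E).
  apply: ge0_le_integral => //.
  - by move=> x _; rewrite lee_fin divr_ge0// expR_ge0.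
  - by apply: measurable_funTS; apply/measurable_EFinP; exact: measurable_gamma_integrand.
  - move=> x /=; rewrite in_itv/= => /andP[x1 x2]; have x0 : 0 < x by rewrite (lt_le_trans ltr01).
    rewrite lee_fin gamma_integrand_gt0E// mulrC ler_pM ?invr_ge0 ?expR_ge0//.
      apply: (@le_trans _ _ (x `^ (-1))).
        by rewrite powR_inv1 ?(ltW x0)// lef_pV2 ?posrE.
      by apply: ler_powR => //; rewrite lerBrDr addNr ltW.
    by rewrite ler_expR lerN2.
apply: ge0_subset_integral => //.
- by apply/measurable_EFinP; exact: measurable_gamma_integrand.
- by move=> x _; rewrite lee_fin gamma_integrand_ge0.
Qed.

Lemma GammaS a : 0 < a -> Gamma (a + 1) = a * Gamma a.
Proof.
move=> a0; apply: EFin_inj.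
by rewrite EFinM -!gamma_integralE ?addr_gt0//; exact: gamma_integralS.
Qed.

Lemma Gamma1 : Gamma (1 : R) = 1.
Proof. by apply: EFin_inj; rewrite -gamma_integralE// gamma_integral1. Qed.

Lemma beta_integralE a b : 0 < a -> 0 < b ->
  beta_integral a b = (Gamma a * Gamma b / Gamma (a + b))%:E.
Proof.
move=> a0 b0; have ab0 : 0 < a + b by rewrite addr_gt0.
rewrite EFinM EFinM -!gamma_integralE// gamma_beta gamma_integralE// muleAC -EFinM.
by rewrite divff ?mul1e// gt_eqF// Gamma_gt0.
Qed.

(* Slicing the region below the graph of [exp(-x^2)] horizontally. *)
Lemma Gamma32 : Gamma (1 / 2 + 1 : R) = Num.sqrt pi / 2.
Proof.
apply: EFin_inj; rewrite -gamma_integralE ?addr_gt0// -integral0y_gauss.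
rewrite -integral_itv_obnd_cbnd; last first.
  by apply/measurable_EFinP; apply: measurable_funTS; exact: measurable_gauss_fun.
(* At w = (x, z) this is exp(-z) on the region x > 0, z > x^2, and 0 elsewhere. Integrating over z
   gives exp(-x^2); integrating over x gives exp(-z) sqrt(z). *)
pose h (w : R * R) : R := \1_`]0%R, +oo[ w.1 * gamma_integrand 1 (w.2 - w.1 ^+ 2) * expR (- w.1 ^+ 2).
pose k (w : R * R) : \bar R := (h w)%:E.
have mk : measurable_fun setT k.
  apply/measurable_EFinP; apply: measurable_funM.
    apply: measurable_funM.
      exact: (@measurableT_comp _ _ _ _ _ _ (\1_`]0%R, +oo[ : R -> R) _ fst).
    apply: (measurableT_comp (measurable_gamma_integrand _)).
    apply: measurable_funB; first exact: measurable_snd.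
    by apply: measurable_funX; exact: measurable_fst.
  apply: measurableT_comp => //; apply: measurableT_comp => //.
  by apply: measurable_funX; exact: measurable_fst.
have k0 w : (0 <= k w)%E.
  rewrite lee_fin; apply: mulr_ge0; last exact: expR_ge0.
  by apply: mulr_ge0 => //; exact: gamma_integrand_ge0.
transitivity (\int[leb]_x \int[leb]_z k (x, z))%E; last first.
  rewrite [RHS]integral_mkcond; apply: eq_integral => x _.
  rewrite patchE /k /h/= indicE; case: ifPn => x0; last first.
    by rewrite integral0_eq// => z _; rewrite !mul0r.
  under eq_integral do rewrite mul1r mulrC EFinM.
  rewrite ge0_integralZl_EFin ?expR_ge0//; last 2 first.
  - by move=> z _; rewrite lee_fin gamma_integrand_ge0.
  - apply/measurable_EFinP; apply: (measurableT_comp (measurable_gamma_integrand _)).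
    exact: measurable_funB.
  rewrite /gauss_fun -[RHS]mule1 -gamma_integral1; congr (_ * _)%E.
  rewrite /gamma_integral [RHS](@ge0_integral_affine _ 1 (- x ^+ 2))// ?mul1e.
  - by apply: eq_integral => z _; rewrite mul1r.
  - by apply/measurable_EFinP; exact: measurable_gamma_integrand.
  - by move=> z; rewrite lee_fin gamma_integrand_ge0.
rewrite (@fubini_tonelli _ _ _ _ _ leb leb k)//.
apply: eq_integral => z _.
have [z0|z0] := leP z 0.
  rewrite gamma_integrand_le0E// integral0_eq// => x _.
  by rewrite /k /h/= gamma_integrand_le0E ?mulr0 ?mul0r// subr_le0 (le_trans z0)// sqr_ge0.
rewrite gamma_integrand_gt0E// addrK div1r powR12_sqrt ?(ltW z0)//.
transitivity (\int[leb]_(x in `]0%R, (Num.sqrt z)%R[) (cst (expR (- z))%:E) x)%E.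
  rewrite integral_cst//= lebesgue_measure_itv/= lte_fin sqrtr_gt0 z0 -EFinD subr0.
  by rewrite -EFinM mulrC.
rewrite [LHS]integral_mkcond; apply: eq_integral => x _.
rewrite patchE /k /h/= indicE.
case: (boolP (x \in `]0, (Num.sqrt z)[%classic)) => [/set_mem|/negP]/=.
  rewrite in_itv/= => /andP[x0 xz]; rewrite mem_set/=; last by rewrite in_itv/= x0.
  have x2z : x ^+ 2 < z.
    by rewrite -(sqr_sqrtr (ltW z0)) ltr_pXn2r// nnegrE ?sqrtr_ge0// ltW.
  rewrite mul1r gamma_integrand_gt0E ?subr_gt0// subrr powRr0 mul1r -expRD.
  by congr (expR _)%:E; ring.
move=> xz; case: (leP x 0) => x0.
  by rewrite memNset ?mul0r//= in_itv/= andbT ltNge x0.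
rewrite gamma_integrand_le0E ?mulr0 ?mul0r// subr_le0.
rewrite -(sqr_sqrtr (ltW z0)) lerXn2r ?nnegrE ?sqrtr_ge0 ?(ltW x0)//.
by rewrite leNgt; apply/negP => h1; apply: xz; rewrite inE/= in_itv/= x0.
Qed.

Lemma Gamma12 : Gamma (1 / 2 : R) = Num.sqrt pi.
Proof. by have := Gamma32; rewrite GammaS//; lra. Qed.

End gamma_and_beta_integrals.

(** * Mellin transforms of measures on the half-line *)

Section mellin_transforms.
Context {R : realType}.
Local Notation leb := (@lebesgue_measure R).
Local Notation MR := (measurableTypeR R).
Implicit Types mu nu : {measure set MR -> \bar R}.

Lemma mellin_nat mu n : mellin mu n%:R = (\int[mu]_(x in `[0%R, +oo[) (x ^+ n)%:E)%E.
Proof.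
apply: eq_integral => x; rewrite inE/= in_itv/= andbT => x0.
by rewrite powR_mulrn.
Qed.

(** Equal moments of geometric growth make the measures equal; agreement at the integers thus passes
    to all real s. *)
Lemma mellin_unique mu nu (m : nat -> R) (K M : R) :
    (forall n, m n <= K * M ^+ n) ->
    stieltjes_represents mu m -> stieltjes_represents nu m ->
  mellin mu =1 mellin nu.
Proof.
move=> mK hmu hnu s; apply: eq_measure_integral => A mA _.
exact: (stieltjes_unique mK hmu hnu).
Qed.

(** The measure is the image under [phi] of the measure with density [f] on [D]. *)
Lemma mellin_density_exists (D : set MR) (f phi : MR -> R) :
    measurable D -> measurable_fun D f -> (forall x, D x -> 0 <= f x) ->
    measurable_fun setT phi -> (forall x, D x -> 0 <= phi x) ->
  exists mu, mu `]-oo, 0%R[%classic = 0%E /\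
    forall s, mellin mu s = (\int[leb]_(x in D) (phi x `^ s * f x)%:E)%E.
Proof.
move=> mD mf f0 mphi phi0.
have [nu [nuE nu_int]] := density_measure_exists leb mD mf f0.
have [mu [muE mu_int]] := pushforward_exists nu (mphi : measurable_fun setT (phi : MR -> MR)).
exists mu; split.
  rewrite muE nuE; last by rewrite -[X in measurable X]setTI; exact: mphi.
  rewrite (_ : _ `&` D = set0) ?integral_set0//.
  apply/seteqP; split => x //= [+ Dx]; rewrite in_itv/=.
  by apply/negP; rewrite -leNgt phi0.
move=> s; rewrite /mellin.
have mpow (E : set MR) : measurable_fun E (fun x : MR => (x `^ s)%:E).
  by apply/measurable_EFinP; apply: measurable_funTS; exact: measurable_powR.
have mpre : measurable (phi @^-1` `[0%R, +oo[%classic).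
  by rewrite -[X in measurable X]setTI; exact: mphi.
rewrite mu_int//; last by move=> y _; rewrite lee_fin powR_ge0.
rewrite nu_int//; last 2 first.
- apply/measurable_EFinP; apply: measurable_funTS.
  by apply: (measurableT_comp (measurable_powR _)).
- by move=> y _; rewrite lee_fin powR_ge0.
rewrite (_ : _ `&` D = D)//; apply: setIidr => x Dx /=.
by rewrite in_itv/= andbT phi0.
Qed.

End mellin_transforms.

Lemma powR2M (R : realType) (s : R) : 2 `^ (2 * s) = 4 `^ s.
Proof. by rewrite powRrM powR_mulrn// -natrX. Qed.

(** * Legendre's duplication formula *)

Section legendre_duplication.
Context {R : realType}.
Local Notation leb := (@lebesgue_measure R).
Implicit Types s : R.

(** This is B(s + 1, s + 1), the integral of (u (1 - u))^s over ]0, 1[. *)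
Let a s : R := Gamma (s + 1) ^+ 2 / Gamma (2 * s + 2).
(** This is 4^(-s) B(s + 1, 1/2) / 2, the integral of (u / 4)^s (1 - u)^(-1/2) / 2 over ]0, 1[. *)
Let b s : R := 2^-1 * 4 `^ (- s) * (Gamma (s + 1) * Num.sqrt pi / Gamma (s + 3 / 2)).

Let aS s : 0 <= s -> a (s + 1) = (s + 1) / (4 * s + 6) * a s.
Proof.
move=> s0; rewrite /a (@GammaS _ (s + 1)); last by lra.
have -> : 2 * (s + 1) + 2 = (2 * s + 2) + 1 + 1 by ring.
rewrite (@GammaS _ (2 * s + 2 + 1)); last by lra.
rewrite (@GammaS _ (2 * s + 2)); last by lra.
have /lt0r_neq0 G0 : 0 < Gamma (2 * s + 2) by apply: Gamma_gt0; lra.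
move: (Gamma (s + 1)) (Gamma (2 * s + 2)) G0 => x y y0.
by field; rewrite y0 !lt0r_neq0//; lra.
Qed.

Let bS s : 0 <= s -> b (s + 1) = (s + 1) / (4 * s + 6) * b s.
Proof.
move=> s0; rewrite /b (@GammaS _ (s + 1)); last by lra.
have -> : s + 1 + 3 / 2 = (s + 3 / 2) + 1 by ring.
rewrite (@GammaS _ (s + 3 / 2)); last by lra.
have /lt0r_neq0 G0 : 0 < Gamma (s + 3 / 2) by apply: Gamma_gt0; lra.
rewrite opprD powRD; last by rewrite pnatr_eq0 implybT.
rewrite powR_inv1//.
move: (Gamma (s + 1)) (Gamma (s + 3 / 2)) (Num.sqrt pi) (4 `^ (- s)) G0 => x y z w y0.
by field; rewrite y0 !lt0r_neq0//; lra.
Qed.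

Let ab_nat n : a n%:R = b n%:R.
Proof.
elim: n => [|n ih]; last first.
  by rewrite -natr1 (aS (ler0n R n)) (bS (ler0n R n)) ih.
have pi0 : 0 < Num.sqrt pi :> R by rewrite sqrtr_gt0 pi_gt0.
rewrite /a /b mulr0 oppr0 powRr0 !add0r Gamma1 (_ : 3 / 2 = 1 / 2 + 1); last by field.
rewrite Gamma32 (_ : 2 = 1 + 1 :> R)// GammaS// Gamma1.
by field; rewrite lt0r_neq0.
Qed.

Let a_le1 n : a n%:R <= 1 * 1 ^+ n.
Proof.
rewrite expr1n mulr1; elim: n => [|n ih].
  by rewrite /a mulr0 !add0r Gamma1 (_ : 2 = 1 + 1 :> R)// GammaS// Gamma1; lra.
rewrite -natr1 aS//; apply: (le_trans _ ih).
have n0 : 0 <= n%:R :> R by [].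
have a0 : 0 <= a n%:R.
  by rewrite /a divr_ge0 ?sqr_ge0// ltW//; apply: Gamma_gt0; lra.
by rewrite ler_piMl// ler_pdivrMr; lra.
Qed.

(* Both sides are Mellin transforms of measures on a bounded interval, and they
   have the same moments. *)
Lemma Gamma_duplication_beta s : 0 <= s -> a s = b s.
Proof.
move=> s0.
have mT (D : set R) (f : R -> R) : measurable_fun setT f -> measurable_fun D f.
  exact: measurable_funTS.
have [mu [mu0 muE]] : exists mu : {measure set (measurableTypeR R) -> \bar R},
    mu `]-oo, 0%R[%classic = 0%E /\ forall t, 0 <= t -> mellin mu t = (a t)%:E.
  have [|||||mu [mu0 muE]] := @mellin_density_exists R `]0%R, 1%R[%classic
    (cst 1) (fun u => u * (1 - u)) => //.
  - by apply: measurable_funM => //; exact: measurable_funB.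
  - by move=> x /=; rewrite in_itv/= => /andP[x0 x1]; rewrite mulr_ge0 ?subr_ge0 ?ltW.
  exists mu; split => // t t0; rewrite muE.
  rewrite /a expr2 (_ : 2 * t + 2 = (t + 1) + (t + 1)); last by ring.
  rewrite -beta_integralE ?ltr_wpDl// beta_integral_itv.
  apply: eq_integral => x; rewrite inE/= in_itv/= => /andP[x0 x1].
  by rewrite mulr1 addrK powRM// ?subr_ge0 ltW.
have [nu [nu0 nuE]] : exists nu : {measure set (measurableTypeR R) -> \bar R},
    nu `]-oo, 0%R[%classic = 0%E /\ forall t, 0 <= t -> mellin nu t = (b t)%:E.
  have [|||||nu [nu0 nuE]] := @mellin_density_exists R `]0%R, 1%R[%classic
    (fun u => 2^-1 * (1 - u) `^ (1 / 2 - 1)) (fun u => u / 4) => //.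
  - apply: mT; apply: measurable_funM => //.
    by apply: (measurableT_comp (measurable_powR _)); exact: measurable_funB.
  - by move=> x _; rewrite mulr_ge0// powR_ge0.
  - exact: mulrr_measurable.
  - by move=> x /=; rewrite in_itv/= => /andP[/ltW x0 _]; rewrite divr_ge0.
  exists nu; split => // t t0; rewrite nuE /b.
  rewrite (_ : t + 3 / 2 = (t + 1) + 1 / 2); last by field.
  rewrite -Gamma12 [RHS]EFinM -beta_integralE ?ltr_wpDl//.
  rewrite beta_integral_itv -ge0_integralZl_EFin//.
  - apply: eq_integral => x; rewrite inE/= in_itv/= => /andP[x0 x1].
    rewrite -EFinM; congr EFin.
    by rewrite addrK powRM ?(ltW x0)// -[4^-1]powR_inv1// -powRrM mulN1r; ring.
  - by move=> x _; rewrite lee_fin mulr_ge0// powR_ge0.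
  - apply/measurable_EFinP; apply: mT; apply: measurable_funM; first exact: measurable_powR.
    by apply: (measurableT_comp (measurable_powR _)); exact: measurable_funB.
apply: EFin_inj; rewrite -muE// -nuE//.
apply: (@mellin_unique _ _ _ (fun n => a n%:R) 1 1) => //.
- by split => // n; rewrite -mellin_nat muE.
- by split => // n; rewrite -mellin_nat nuE// ab_nat.
Qed.

Lemma Gamma_duplication s : 0 <= s ->
  2 `^ (2 * s) * Gamma (s + 1 / 2) * Gamma (s + 1) = Num.sqrt pi * Gamma (2 * s + 1).
Proof.
move=> s0; have := Gamma_duplication_beta s0; rewrite /a /b powRN powR2M.
have -> : 2 * s + 2 = (2 * s + 1) + 1 by ring.
have -> : s + 3 / 2 = (s + 1 / 2) + 1 by field.
rewrite (@GammaS _ (2 * s + 1)); last by lra.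
rewrite (@GammaS _ (s + 1 / 2)); last by lra.
have g1 : 0 < Gamma (s + 1) by apply: Gamma_gt0; lra.
have g2 : 0 < Gamma (2 * s + 1) by apply: Gamma_gt0; clear g1; lra.
have g3 : 0 < Gamma (s + 1 / 2) by apply: Gamma_gt0; clear g1 g2; lra.
have p4 : 0 < 4 `^ s :> R by rewrite powR_gt0.
move: (Gamma (s + 1)) (Gamma (2 * s + 1)) (Gamma (s + 1 / 2)) (4 `^ s) (Num.sqrt pi) g1 g2 g3 p4.
move=> x y z w q x0 y0 z0 w0 h.
(* Splits off the left side of [h], so that the Beta identity can be substituted. *)
have -> : w * z * x = (x ^+ 2 / ((2 * s + 1) * y)) * ((2 * s + 1) * y * w * z / x).
  by field; rewrite !lt0r_neq0//; lra.
by rewrite h; field; rewrite !lt0r_neq0//; lra.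
Qed.

End legendre_duplication.

(** * Gamma laws and the compound Poisson exponent *)

Section catalan_power_measures.
Context {R : realType}.
Local Notation leb := (@lebesgue_measure R).
Local Notation MR := (measurableTypeR R).

(** The law has density x^(p - 1) exp(-x) / Gamma(p) on ]0, +oo[; the dilation by s + 1 absorbs the
    factor exp(-s x). *)
Lemma laplace_gamma_law (p : R) : 0 < p -> laplace_transform (fun s : R => (s + 1) `^ (- p)).
Proof.
move=> p0; have G0 := Gamma_gt0 p0.
have mg := @measurable_gamma_integrand R p.
have [|||nu [_ nu_int]] := @density_measure_exists _ MR R leb setT
    (fun x => gamma_integrand p x / Gamma p) => //.
- by apply: measurable_funM => //; exact: mg.
- by move=> x _; rewrite divr_ge0 ?gamma_integrand_ge0// ltW.
exists nu => s s0; have s1 : 0 < s + 1 by rewrite ltr_wpDl.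
rewrite nu_int//; last exact: measurable_expR_NM.
rewrite setIT.
transitivity (((s + 1) `^ (1 - p) / Gamma p)%:E *
    \int[leb]_x (gamma_integrand p ((s + 1) * x + 0))%:E)%E.
  rewrite -ge0_integralZl_EFin//.
  - apply: eq_integral => x _; rewrite -!EFinM addr0; congr EFin.
    have [x0|x0] := leP x 0.
      by rewrite !gamma_integrand_le0E ?mul0r ?mulr0// pmulr_rle0.
    rewrite !gamma_integrand_gt0E ?mulr_gt0// powRM ?(ltW x0) ?(ltW s1)//.
    have -> : expR (- ((s + 1) * x)) = expR (- (s * x)) * expR (- x).
      by rewrite -expRD; congr expR; ring.
    have -> : (s + 1) `^ (1 - p) = ((s + 1) `^ (p - 1))^-1 by rewrite -powRN opprB.
    have : 0 < (s + 1) `^ (p - 1) by rewrite powR_gt0.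
    move: ((s + 1) `^ _) (x `^ _) (Gamma p) G0 => u v g g0 u0.
    by field; rewrite !lt0r_neq0.
  - by move=> x _; rewrite lee_fin gamma_integrand_ge0.
  - apply/measurable_EFinP; apply: (measurableT_comp mg).
    by apply: measurable_funD => //; exact: mulrl_measurable.
  - by rewrite divr_ge0 ?powR_ge0// ltW.
have : ((s + 1)%:E * \int[leb]_x (gamma_integrand p ((s + 1) * x + 0))%:E = (Gamma p)%:E)%E.
  rewrite -(@ge0_integral_affine _ (s + 1) 0 (fun x => (gamma_integrand p x)%:E))//.
  - exact: gamma_integralE.
  - by apply/measurable_EFinP; exact: mg.
  - by move=> x; rewrite lee_fin gamma_integrand_ge0.
move=> h; have -> : (s + 1) `^ (1 - p) / Gamma p = (s + 1) `^ (- p) / Gamma p * (s + 1).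
  rewrite powRD ?(gt_eqF s1) ?implybT// powRr1 ?(ltW s1)//; ring.
by rewrite EFinM -muleA h -EFinM divfK// lt0r_neq0.
Qed.

(** A Frullani integral: the inner integral is 1 / (n + 1 + w), whose primitive in w is a
    logarithm. *)
Lemma integral_powR_log (n : nat) :
  (\int[leb]_(w in `]0%R, 1%R[) \int[leb]_(v in `]0%R, 1%R[) (v `^ (n%:R + w))%:E =
   (ln n.+2%:R - ln n.+1%:R)%:E)%E.
Proof.
transitivity (\int[leb]_(w in `]0%R, 1%R[) ((n.+1%:R + w)^-1)%:E)%E.
  apply: eq_integral => w; rewrite inE/= in_itv/= => /andP[w0 w1].
  rewrite integral_powR01; last by rewrite (lt_trans (ltrN10 _))// ltr_wpDl.
  by rewrite addrAC natr1.
have pos (x : R) : 0 <= x <= 1 -> 0 < n.+1%:R + x by move=> /andP[x0 _]; rewrite ltr_pwDl.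
have dF (x : R) : 0 <= x <= 1 ->
    is_derive x 1 (fun y : R => ln (n.+1%:R + y)) ((n.+1%:R + x)^-1).
  move=> /pos px; have dln := is_derive1_ln px.
  have dg : is_derive x 1 (fun y : R => n.+1%:R + y) (0 + 1) by exact: is_deriveD.
  by have := is_derive1_comp dln dg; rewrite add0r mulr1.
have cf (x : R) : 0 <= x <= 1 -> {for x, continuous (fun y : R => (n.+1%:R + y)^-1)}.
  move=> /pos px; apply: (@cvgV _ _ (nbhs x)); first by rewrite gt_eqF.
  by apply: cvgD; [exact: cvg_cst|exact: cvg_id].
have := integral_is_derive ltr01 dF cf; rewrite addr0 natr1 => <-.
have mf (D : set R) : measurable_fun D (fun x : R => ((n.+1%:R + x)^-1)%:E).
  by apply/measurable_EFinP; apply: measurable_funTS; apply: measurable_funV; exact: measurable_funD.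
by rewrite integral_itv_bndo_bndc// integral_itv_obnd_cbnd.
Qed.

(* The density of this measure is [\int_0^1 v^w dw = (1 - v) / (- ln v)]. *)
Lemma log_measure_exists : exists kappa : {measure set MR -> \bar R},
  forall n : nat, (\int[kappa]_(v in `]0%R, 1%R[) (v ^+ n)%:E =
    (ln n.+2%:R - ln n.+1%:R)%:E)%E.
Proof.
pose I : set MR := `]0%R, 1%R[%classic.
have mI : measurable I by exact: measurable_itv.
(* This is v^w at z = (v, w), in a form whose joint measurability is immediate; [kappa] is the first
   marginal of this density on the unit square. *)
pose f (z : MR * MR) : R := expR (z.2 * ln z.1).
have mf : measurable_fun setT f.
  apply: measurableT_comp => //; apply: measurable_funM; first exact: measurable_snd.
  exact: (measurableT_comp (@measurable_ln R) measurable_fst).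
have mII : measurable (I `*` I) by exact: measurableX.
have [|||nu [_ nu_int]] := @density_measure_exists _ _ R (leb \x leb)%E (I `*` I) f => //.
- exact: measurable_funTS.
- by move=> z _; exact: expR_ge0.
have [kappa [_ kappaE]] := pushforward_exists nu (@measurable_fst _ _ MR MR).
exists kappa => n; rewrite -integral_powR_log.
have mX (D : set MR) : measurable_fun D (fun v : MR => (v ^+ n)%:E).
  by apply/measurable_EFinP; exact: measurable_funX.
have mXI : measurable (fst @^-1` I : set (MR * MR)).
  by rewrite -[X in measurable X]setTI; exact: measurable_fst.
have I0 x : I x -> 0 < x < 1 by rewrite /I/= in_itv.
rewrite kappaE//; last by move=> v /I0/andP[/ltW v0 _]; rewrite lee_fin exprn_ge0.
rewrite nu_int//; last 2 first.
- apply/measurable_EFinP; apply: measurable_funX; apply: measurable_funTS.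
  exact: measurable_fst.
- by move=> z /I0/andP[/ltW v0 _]; rewrite lee_fin exprn_ge0.
have -> : fst @^-1` I `&` I `*` I = I `*` I by apply: setIidr => z [].
rewrite integral_mkcond.
rewrite (@fubini_tonelli2 _ _ _ _ _ leb leb); last 2 first.
- apply/(measurable_restrictT _ mII); apply/measurable_EFinP.
  apply: measurable_funM; last exact: measurable_funTS.
  by apply: measurable_funX; apply: measurable_funTS; exact: measurable_fst.
- apply: erestrict_ge0 => z [/I0/andP[/ltW v0 _] _].
  by rewrite mule_ge0 ?lee_fin ?exprn_ge0 ?expR_ge0.
rewrite [RHS]integral_mkcond; apply: eq_integral => w _.
rewrite /fubini_G patchE; case: ifPn => [/set_mem wI|wI].
  rewrite [RHS]integral_mkcond; apply: eq_integral => v _; rewrite !patchE.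
  case: ifPn => [/set_mem[/= vI _]|/negP vw]; last first.
    by case: ifPn => // /set_mem vI; exfalso; apply: vw; rewrite inE.
  rewrite mem_set//; have /andP[v0 _] := I0 _ vI.
  rewrite /f/= -EFinM; congr EFin.
  rewrite powRD; last by rewrite (gt_eqF v0) implybT.
  by rewrite powR_mulrn ?(ltW v0)// /powR (gt_eqF v0).
apply: integral0_eq => v _; rewrite patchE; case: ifPn => // /set_mem[_ /= wI'].
by move/negP : wI; rewrite inE.
Qed.

(** The required increments of [rho] are the [kappa]-integrals of v^(2n) (1 - v/2 - v^2/2); dividing
    by 1 - v^2 gives this weight. It is nonnegative on ]0, 1[, so it is a density. *)
Let weight (v : R) : R := (v + 2) / (2 * (1 + v)).

(* [rho] is the Laplace exponent of the compound Poisson factor. *)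
Lemma poisson_exponent_exists : exists rho : R -> R,
  laplace_transform rho /\ forall n : nat, rho n%:R - rho n.+1%:R =
    (ln (2 * n + 2)%:R - ln (2 * n + 1)%:R) -
    (ln (2 * n + 4)%:R - ln (2 * n + 2)%:R) / 2.
Proof.
have [kappa kappaE] := log_measure_exists.
pose I : set MR := `]0%R, 1%R[%classic.
have mI : measurable I by exact: measurable_itv.
have I01 x : I x -> 0 < x < 1 by rewrite /I/= in_itv.
have mw : measurable_fun setT weight.
  apply: measurable_funM; first exact: measurable_funD.
  by apply: measurable_funV; apply: measurable_funM => //; exact: measurable_funD.
have mwI : measurable_fun I weight by exact: measurable_funTS.
have w0 x : I x -> 0 <= weight x.
  by move=> /I01/andP[x0 x1]; rewrite /weight divr_ge0//; lra.
have w1 x : I x -> weight x <= 1.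
  by move=> /I01/andP[x0 x1]; rewrite /weight ler_pdivrMr; lra.
have [nu [_ nu_int]] := density_measure_exists kappa mI mwI w0.
(* The substitution x = -2 ln v turns v^(2s) into exp(-s x). *)
have mphi : measurable_fun setT (fun v : MR => - 2 * ln v : MR).
  by apply: measurable_funM => //; exact: measurable_ln.
have [la [_ la_int]] := pushforward_exists nu mphi.
pose e (s : R) := (\int[kappa]_(v in I) (expR (2 * s * ln v) * weight v)%:E)%E.
have laE s : (\int[la]_x (expR (- (s * x)))%:E = e s)%E.
  rewrite la_int//; last exact: measurable_expR_NM.
  rewrite preimage_setT nu_int//; last first.
    exact: (measurableT_comp (measurable_expR_NM s) mphi).
  rewrite setTI; apply: eq_integral => v _; rewrite -EFinM; congr (expR _ * _)%:E.
  by ring.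
have mexp s : measurable_fun I (fun v : MR => (expR (2 * s * ln v) * weight v)%:E).
  apply/measurable_EFinP; apply: measurable_funM => //; apply: measurable_funTS.
  by apply: measurableT_comp => //; apply: measurable_funM.
(* Both factors are at most 1 on ]0, 1[, and [kappa] has mass ln 2 there. *)
have e_lty s : 0 <= s -> (e s < +oo)%E.
  move=> s0; apply: (@le_lt_trans _ _ (\int[kappa]_(v in I) (v ^+ 0)%:E)%E); last first.
    by rewrite kappaE ltry.
  apply: ge0_le_integral => //.
  - by move=> v /w0 ?; rewrite lee_fin mulr_ge0// expR_ge0.
  - by apply/measurable_EFinP; exact: measurable_funX.
  - move=> v Iv; rewrite lee_fin expr0 -[leRHS]mulr1 ler_pM ?expR_ge0 ?w0 ?w1//.
    rewrite -expR0 ler_expR; apply: mulr_ge0_le0; first by rewrite mulr_ge0.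
    by have /andP[_ /ltW v1] := I01 _ Iv; exact: ln_le0.
have eE s : 0 <= s -> e s = (fine (e s))%:E.
  move=> s0; rewrite fineK// ge0_fin_numE ?e_lty//.
  by apply: integral_ge0 => v /w0 ?; rewrite lee_fin mulr_ge0// expR_ge0.
exists (fun s => fine (e s)); split; first by exists la => s s0; rewrite laE eE.
move=> n.
have mX k : measurable_fun I (fun v : MR => (v ^+ k)%:E).
  by apply/measurable_EFinP; exact: measurable_funX.
have X0 k v : I v -> (0 <= (v ^+ k)%:E)%E.
  by move=> /I01/andP[/ltW v0 _]; rewrite lee_fin exprn_ge0.
have expE k v : I v -> expR (2 * k%:R * ln v) = v ^+ (2 * k).
  move=> /I01/andP[v0 _]; rewrite -natrM mulrC expRM_natr lnK//.
pose half k := (\int[kappa]_(v in I) (2^-1 * v ^+ k)%:E)%E.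
have halfE k : half k = (2^-1 * (ln k.+2%:R - ln k.+1%:R))%:E.
  rewrite /half; under eq_integral do rewrite EFinM.
  by rewrite ge0_integralZl_EFin ?kappaE//; exact: X0.
have mhalf k : measurable_fun I (fun v : MR => (2^-1 * v ^+ k)%:E).
  by apply/measurable_EFinP; apply: measurable_funM => //; exact: measurable_funX.
have half0 k v : I v -> (0 <= (2^-1 * v ^+ k)%:E)%E.
  by move=> /I01/andP[/ltW v0 _]; rewrite lee_fin mulr_ge0 ?exprn_ge0.
have exp0 s v : I v -> (0 <= (expR (2 * s * ln v) * weight v)%:E)%E.
  by move=> /w0 ?; rewrite lee_fin mulr_ge0// expR_ge0.
have mhalf2 j k : measurable_fun I (fun v : MR => (2^-1 * v ^+ j + 2^-1 * v ^+ k)%:E).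
  by apply/measurable_EFinP; apply: measurable_funD; apply/measurable_EFinP; exact: mhalf.
have half20 j k v : I v -> (0 <= (2^-1 * v ^+ j + 2^-1 * v ^+ k)%:E)%E.
  by move=> Iv; rewrite EFinD adde_ge0//; exact: half0.
(* The increment relation is proved with every term moved to the side where it is added, which
   avoids subtraction of extended reals. *)
have addE (f g : MR -> R) :
    measurable_fun I (fun v => (f v)%:E) -> measurable_fun I (fun v => (g v)%:E) ->
    (forall v, I v -> (0 <= (f v)%:E)%E) -> (forall v, I v -> (0 <= (g v)%:E)%E) ->
    (\int[kappa]_(v in I) (f v)%:E + \int[kappa]_(v in I) (g v)%:E =
     \int[kappa]_(v in I) (f v + g v)%:E)%E.
  by move=> mf mg f0 g0; rewrite -(ge0_integralD _ mI f0 mf g0 mg).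
(* [(1 - v^2) weight v = 1 - v / 2 - v^2 / 2] *)
have : (e n%:R + (half (2 * n).+1 + half (2 * n).+2) =
        e n.+1%:R + \int[kappa]_(v in I) (v ^+ (2 * n))%:E)%E.
  rewrite /half addE; [|exact: mhalf|exact: mhalf|exact: half0|exact: half0].
  rewrite /e addE; [|exact: mexp|exact: mhalf2|exact: exp0|exact: half20].
  rewrite addE; [|exact: mexp|exact: mX|exact: exp0|exact: X0].
  apply: eq_integral => v /[!inE] Iv; congr EFin.
  rewrite !expE//; have /andP[v0 v1] := I01 _ Iv.
  have -> : (2 * n.+1 = (2 * n).+2)%N by lia.
  rewrite /weight !exprS; field; apply: lt0r_neq0; lra.
rewrite !halfE kappaE; case: (e n%:R) (eE n%:R (ler0n _ _)) => // x _.
case: (e n.+1%:R) (eE n.+1%:R (ler0n _ _)) => // y _ /=; rewrite -!EFinD => -[].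
have -> : ((2 * n).+1 = 2 * n + 1)%N by lia.
have -> : (2 * n + 2 = (2 * n + 1).+1)%N by lia.
have -> : (2 * n + 4 = (2 * n + 1).+3)%N by lia.
lra.
Qed.

End catalan_power_measures.

(** * Catalan numbers, their Mellin interpolation and representing measures *)

Section catalan_measures.
Context {R : realType}.
Local Notation leb := (@lebesgue_measure R).
Local Notation MR := (measurableTypeR R).

Lemma catalan0 : catalan R 0 = 1.
Proof. by rewrite /catalan bin0 divr1. Qed.

(** The ratio is put in the form shared by 4^s psi(s) and the Gamma quotient; as it is at most 4, it
    also gives the growth bound. *)
Lemma catalanS n :
  catalan R n.+1 = 4 * (n%:R + 1 / 2) / (n%:R + 2) * catalan R n.
Proof.
have fn0 k : k`!%:R != 0 :> R by rewrite pnatr_eq0 -lt0n fact_gt0.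
have n0 : 0 <= n%:R :> R by [].
rewrite !catalan_fact doubleS !factS !natrM.
have -> : n.*2.+2%:R = 2 * (n%:R + 1) :> R by rewrite -muln2 -natr1 -natr1 natrM; ring.
have -> : n.*2.+1%:R = 2 * n%:R + 1 :> R by rewrite -muln2 -natr1 natrM; ring.
have -> : n.+2%:R = n%:R + 2 :> R by rewrite -natr1 -natr1; ring.
have -> : n.+1%:R = n%:R + 1 :> R by rewrite -natr1.
move: (n%:R) (n.*2`!%:R) (n`!%:R) (fn0 n) n0 => x y z z0 x0.
by field; rewrite z0 !lt0r_neq0//; lra.
Qed.

Lemma catalan_gt0 n : 0 < catalan R n.
Proof. by rewrite catalan_fact divr_gt0 ?mulr_gt0 ?ltr0n ?fact_gt0. Qed.

Lemma catalan_le n : catalan R n <= 4 ^+ n.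
Proof.
elim: n => [|n ih]; first by rewrite catalan0.
rewrite catalanS exprS; apply: ler_pM => //.
- by rewrite divr_ge0// ?mulr_ge0 ?addr_ge0.
- have n0 : 0 <= n%:R :> R by [].
  by rewrite ler_pdivrMr; lra.
Qed.

Lemma catalan_power_le (c : R) n : 0 < c -> catalan R n `^ c <= 1 * (4 `^ c) ^+ n.
Proof.
move=> c0; rewrite mul1r -powR_mulrn ?powR_ge0// powRAC powR_mulrn//.
apply: ge0_ler_powR; rewrite ?nnegrE ?exprn_ge0 ?catalan_le//; first exact: ltW.
exact: ltW (catalan_gt0 n).
Qed.

(** Here 4^s psi(s) interpolates the Catalan numbers and all its positive powers are Mellin
    transforms; it is identified with the Gamma quotient afterwards, by uniqueness. *)
Lemma catalan_root_exists : exists psi : R -> R,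
  [/\ forall s, 0 <= psi s,
   forall n : nat, 4 `^ n%:R * psi n%:R = catalan R n &
   forall c : R, 0 < c -> exists mu : {measure set MR -> \bar R},
     mu `]-oo, 0%R[%classic = 0%E /\
     forall s, 0 <= s -> mellin mu s = ((4 `^ s * psi s) `^ c)%:E].
Proof.
have [rho [rho_laplace rhoE]] := @poisson_exponent_exists R.
(* Subtracting [rho 0] normalises psi(0) = 1, the zeroth Catalan number. *)
pose psi s : R := expR (- (3 / 2) * ln (s + 1) + (rho s - rho 0)).
exists psi; split; first by move=> s; exact: expR_ge0.
  have psi_step n : psi n.+1%:R = (n%:R + 1 / 2) / (n%:R + 2) * psi n%:R.
    have n0 : 0 <= n%:R :> R by [].
    rewrite /psi -[X in X / _ * _]lnK ?posrE; last by lra.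
    rewrite -[X in _ / X * _]lnK ?posrE; last by lra.
    rewrite -expRN -!expRD; congr expR.
    have ln2M (x : R) : 0 < x -> ln (2 * x) = ln 2 + ln x by move=> x0; rewrite lnM ?posrE.
    have := rhoE n.
    have -> : (2 * n + 2)%:R = 2 * (n%:R + 1) :> R by rewrite natrD natrM; ring.
    have -> : (2 * n + 4)%:R = 2 * (n%:R + 2) :> R by rewrite natrD natrM; ring.
    have -> : (2 * n + 1)%:R = 2 * (n%:R + 1 / 2) :> R by rewrite natrD natrM; field.
    rewrite !ln2M; [|lra..].
    have -> : n.+1%:R + 1 = n%:R + 2 :> R by rewrite -natr1; ring.
    lra.
  elim=> [|n ih]; first by rewrite powRr0 mul1r catalan0 /psi add0r ln1 mulr0 subrr addr0 expR0.
  rewrite catalanS -ih psi_step !powR_mulrn// exprS.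
  by move: (4 ^+ n) (psi _) => x y; ring.
move=> c c0.
have laplace_psi : laplace_transform (fun s => psi s `^ c).
  have p0 : 0 < 3 / 2 * c by rewrite mulr_gt0.
  (* The factors are (s + 1)^(-3c/2), the constant exp(-c rho(0)) and exp(c rho(s)). *)
  apply: eq_laplace (laplaceM (laplace_gamma_law p0)
    (laplaceZ (expR_ge0 (- (c * rho 0))) (laplace_expR (laplaceZ (ltW c0) rho_laplace)))).
  move=> s s0; rewrite /psi -expRM /powR gt_eqF ?ltr_wpDl// -!expRD; congr expR.
  by ring.
have [m mE] := laplace_psi.
(* The s-th power of 4^c exp(-x) is 4^(c s) exp(-s x), which turns a Laplace transform into a Mellin
   transform. *)
have mphi : measurable_fun setT (fun x : MR => 4 `^ c * expR (- x) : MR).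
  by apply: measurable_funM => //; apply: measurableT_comp => //; exact: measurableT_comp.
have [mu [muE mu_int]] := pushforward_exists m mphi.
have phi0 x : 0 <= 4 `^ c * expR (- x) by rewrite mulr_ge0 ?powR_ge0 ?expR_ge0.
exists mu; split.
  rewrite muE (_ : _ @^-1` _ = set0) ?measure0//; apply/seteqP; split => x //=.
  by rewrite in_itv/= ltNge phi0.
move=> s s0; rewrite /mellin mu_int//.
- rewrite (_ : _ @^-1` _ = setT); last first.
    by apply/seteqP; split => x //= _; rewrite in_itv/= phi0.
  rewrite powRM ?powR_ge0 ?expR_ge0// EFinM -mE//.
  rewrite -ge0_integralZl_EFin ?powR_ge0//; last exact: measurable_expR_NM.
  apply: eq_integral => x _; rewrite -EFinM powRM ?powR_ge0 ?expR_ge0//.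
  by rewrite powRAC -expRM mulNr (mulrC x).
- by apply/measurable_EFinP; apply: measurable_funTS; exact: measurable_powR.
- by move=> x _; rewrite lee_fin powR_ge0.
Qed.

Definition catalan_mellin (s : R) : R :=
  2 `^ (2 * s) / Num.sqrt pi * (Gamma (s + 1 / 2) / Gamma (s + 2)).

Lemma catalan_mellin_nat n : catalan_mellin n%:R = catalan R n.
Proof.
have pi0 : 0 < Num.sqrt pi :> R by rewrite sqrtr_gt0 pi_gt0.
rewrite /catalan_mellin powR2M; elim: n => [|n ih].
  rewrite catalan0 powRr0 !add0r Gamma12 (_ : 2 = 1 + 1 :> R)// GammaS// Gamma1.
  by field; rewrite lt0r_neq0.
have n0 : 0 <= n%:R :> R by [].
rewrite catalanS -ih !powR_mulrn// exprS.
have -> : n.+1%:R = n%:R + 1 :> R by rewrite natr1.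
have -> : n%:R + 1 + 1 / 2 = (n%:R + 1 / 2) + 1 :> R by ring.
have -> : n%:R + 1 + 2 = (n%:R + 2) + 1 :> R by ring.
rewrite (@GammaS _ (n%:R + 1 / 2)); last by lra.
rewrite (@GammaS _ (n%:R + 2)); last by lra.
have G0 : 0 < Gamma (n%:R + 2 : R) by apply: Gamma_gt0; lra.
move: (4 ^+ n) (Gamma (n%:R + 1 / 2)) (Gamma (n%:R + 2)) (Num.sqrt pi) pi0 G0.
by move=> w x y z z0 y0; field; rewrite !lt0r_neq0//; lra.
Qed.

Lemma catalan_mellin_duplication s : 0 <= s ->
  catalan_mellin s = (s + 1)^-1 * (Gamma (2 * s + 1) / Gamma (s + 1) ^+ 2).
Proof.
move=> s0; have := Gamma_duplication s0; rewrite /catalan_mellin.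
have -> : s + 2 = (s + 1) + 1 by ring.
rewrite (@GammaS _ (s + 1)); last by lra.
have pi0 : 0 < Num.sqrt pi :> R by rewrite sqrtr_gt0 pi_gt0.
have G0 : 0 < Gamma (s + 1) by apply: Gamma_gt0; rewrite ltr_wpDl.
move: (2 `^ _) (Gamma (s + 1 / 2)) (Gamma (s + 1)) (Gamma (2 * s + 1)) (Num.sqrt pi) pi0 G0.
move=> w x y z q q0 y0 h.
have -> : z = w * x * y / q by rewrite h mulrAC divff ?mul1r// lt0r_neq0.
by field; rewrite !lt0r_neq0//; lra.
Qed.

(** The substitution x = 4 u produces 4^(s + 1) B(s + 1/2, 3/2) / (2 pi), and Gamma(3/2) = sqrt(pi)
    / 2. *)
Lemma catalan_density_mellin s : 0 <= s ->
  (\int[leb]_(x in `]0%R, 4%R]) (x `^ s * catalan_density x)%:E = (catalan_mellin s)%:E)%E.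
Proof.
move=> s0; rewrite integral_mkcond.
set G := (_ \_ _).
have msqrt : measurable_fun setT (@Num.sqrt R).
  by apply: continuous_measurable_fun; exact: sqrt_continuous.
have mG : measurable_fun setT G.
  apply/(measurable_restrictT _ (measurable_itv _)); apply/measurable_EFinP.
  apply: measurable_funTS; apply: measurable_funM; first exact: measurable_powR.
  apply: measurable_funM => //; apply: (measurableT_comp msqrt).
  by apply: measurable_funM; [exact: measurable_funB|exact: measurable_funV].
have G0 x : (0 <= G x)%E.
  apply: erestrict_ge0 => y _; rewrite lee_fin mulr_ge0 ?powR_ge0//.
  by rewrite mulr_ge0 ?sqrtr_ge0// invr_ge0 mulr_ge0// pi_ge0.
rewrite (@ge0_integral_affine _ 4 0)//.
have pi0 : 0 < pi :> R by exact: pi_gt0.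
transitivity (4%:E * \int[leb]_u ((4 `^ s / (2 * pi))%:E *
    (beta_integrand (s + 1 / 2) (1 / 2 + 1) u)%:E))%E.
  congr (_ * _)%E; apply: eq_integral => u _; rewrite addr0 /G patchE.
  have [u01|u01] := boolP (0 < u < 1).
    have /andP[u0 u1] := u01; rewrite mem_set; last by rewrite /= in_itv/=; lra.
    rewrite -EFinM; congr EFin; rewrite beta_integrandE// /catalan_density.
    have u1' : 0 < 1 - u by rewrite subr_gt0.
    have -> : (4 - 4 * u) / (4 * u) = (1 - u) / u by field; rewrite lt0r_neq0.
    have -> : Num.sqrt ((1 - u) / u) = (1 - u) `^ 2^-1 * u `^ (-1 * 2^-1).
      rewrite -powR12_sqrt ?divr_ge0 ?(ltW u0) ?(ltW u1')//.
      by rewrite powRM ?invr_ge0 ?(ltW u0) ?(ltW u1')// powRrM powR_inv1 ?(ltW u0).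
    rewrite powRM ?(ltW u0)// addrK div1r.
    have -> : s + 2^-1 - 1 = s + -1 * 2^-1 by field.
    rewrite (@powRD _ u s); last by rewrite (gt_eqF u0) implybT.
    by move: (4 `^ s) (u `^ s) (2 * pi)^-1 (_ `^ 2^-1) (_ `^ _) => *; ring.
  (* Outside ]0, 1[ only u = 1 has 4 u in ]0, 4], and the density vanishes there. *)
  rewrite beta_integrandN// mule0; case: ifPn => // /set_mem/=; rewrite in_itv/= => u4.
  have -> : u = 1 by move: u01; rewrite negb_and -!leNgt; lra.
  by rewrite /catalan_density mulr1 subrr mul0r sqrtr0 !mulr0.
rewrite ge0_integralZl_EFin//.
- rewrite -/(beta_integral _ _) beta_integralE ?Gamma32; [|lra..].
  rewrite -!EFinM; congr EFin; rewrite /catalan_mellin powR2M.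
  have -> : s + 1 / 2 + (1 / 2 + 1) = s + 2 by field.
  have G2 : 0 < Gamma (s + 2) by apply: Gamma_gt0; rewrite ltr_wpDl.
  have sq0 : 0 < Num.sqrt pi :> R by rewrite sqrtr_gt0.
  (* Writing pi as sqrt(pi)^2 makes the identity rational in sqrt(pi); the pi under the root is hit
     too and is restored next. *)
  rewrite -[in LHS](sqr_sqrtr (ltW pi0)).
  rewrite [Num.sqrt (_ ^+ 2)]sqrtr_sqr ger0_norm ?(ltW sq0)//.
  move: (Num.sqrt pi) (4 `^ s) (Gamma (s + 1 / 2)) (Gamma (s + 2)) sq0 G2.
  by move=> q w x y q0 y0; field; rewrite !lt0r_neq0.
- by move=> u _; rewrite lee_fin beta_integrand_ge0.
- by apply/measurable_EFinP; exact: measurable_beta_integrand.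
- by rewrite divr_ge0 ?powR_ge0// mulr_ge0// ltW.
Qed.

Lemma catalan_measure_exists : exists nu : {measure set MR -> \bar R},
  [/\ forall A, measurable A ->
        nu A = (\int[leb]_(x in A `&` `]0%R, 4%R]) (catalan_density x)%:E)%E,
      stieltjes_represents nu (catalan R) &
      forall s, 0 <= s -> mellin nu s = (catalan_mellin s)%:E].
Proof.
have msqrt : measurable_fun setT (@Num.sqrt R).
  by apply: continuous_measurable_fun; exact: sqrt_continuous.
have [|||nu [nuE nu_int]] := @density_measure_exists _ MR R leb `]0%R, 4%R]%classic
    (@catalan_density R) => //.
- apply: measurable_funTS; apply: measurable_funM => //; apply: (measurableT_comp msqrt).
  by apply: measurable_funM; [exact: measurable_funB|exact: measurable_funV].
- by move=> x _; rewrite mulr_ge0 ?sqrtr_ge0// invr_ge0 mulr_ge0// pi_ge0.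
have nu_mellin s : 0 <= s -> mellin nu s = (catalan_mellin s)%:E.
  move=> s0; rewrite -catalan_density_mellin// /mellin nu_int//.
  - rewrite (_ : _ `&` _ = `]0%R, 4%R]%classic)//; apply: setIidr => x /=.
    by rewrite !in_itv/= andbT => /andP[/ltW].
  - by apply/measurable_EFinP; apply: measurable_funTS; exact: measurable_powR.
  - by move=> x _; rewrite lee_fin powR_ge0.
exists nu; split => //; split.
  rewrite nuE// (_ : _ `&` _ = set0) ?integral_set0//; apply/seteqP; split => x //= [].
  by rewrite !in_itv/= => x0 /andP[/ltW]; rewrite leNgt x0.
by move=> n; rewrite -mellin_nat nu_mellin// catalan_mellin_nat.
Qed.

(** For c = 1 the constructed measure and the one with the explicit density share the Catalan
    moments, so 4^s psi(s) is the Gamma quotient for all s >= 0; this carries over to every c. *)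
Lemma catalan_power_measure_exists (c : R) : 0 < c ->
  exists mu : {measure set MR -> \bar R},
    stieltjes_represents mu (fun n => catalan R n `^ c) /\
    forall s, 0 <= s -> mellin mu s = (catalan_mellin s `^ c)%:E.
Proof.
have catalan1 n : catalan R n `^ 1 = catalan R n by rewrite powRr1// ltW// catalan_gt0.
have [psi [psi0 psi_nat psi_mu]] := catalan_root_exists.
have rep (d : R) (mu : {measure set MR -> \bar R}) : mu `]-oo, 0%R[%classic = 0%E ->
    (forall s, 0 <= s -> mellin mu s = ((4 `^ s * psi s) `^ d)%:E) ->
    stieltjes_represents mu (fun n => catalan R n `^ d).
  by move=> mu0 muE; split => // n; rewrite -mellin_nat muE// psi_nat.
have psiE s : 0 <= s -> 4 `^ s * psi s = catalan_mellin s.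
  move=> s0; have [mu [mu0 muE]] := psi_mu 1 ltr01.
  have [nu [_ nu_rep nu_mellin]] := catalan_measure_exists.
  have nu_rep1 : stieltjes_represents nu (fun n => catalan R n `^ 1).
    by rewrite (_ : (fun n => _) = catalan R)//; apply/funext => n; exact: catalan1.
  have := mellin_unique (fun n => catalan_power_le n ltr01) (rep 1 mu mu0 muE) nu_rep1 s.
  rewrite muE// nu_mellin// => -[].
  by rewrite powRr1// mulr_ge0 ?powR_ge0.
move=> c0; have [mu [mu0 muE]] := psi_mu c c0; exists mu; split; first exact: rep.
by move=> s s0; rewrite muE// psiE.
Qed.

End catalan_measures.

(** * Infinite divisibility, determinacy and Mellin transforms of the Catalan powers *)

Unset Implicit Arguments.
Set Strict Implicit.

Theorem theorem1 (R : realType) :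
  [/\ stieltjes_infinitely_divisible (catalan R),
      (forall c : R, 0 < c ->
         stieltjes_determinate (fun n => catalan R n `^ c)),
      (forall mu : {measure set (measurableTypeR R) -> \bar R},
         stieltjes_represents mu (fun n => catalan R n `^ 1) ->
         forall A : set (measurableTypeR R), measurable A ->
           mu A = (\int[@lebesgue_measure R]_(x in A `&` `]0%R, 4%R])
                     (catalan_density x)%:E)%E) &
      (forall (c : R) (mu : {measure set (measurableTypeR R) -> \bar R}),
         0 < c ->
         stieltjes_represents mu (fun n => catalan R n `^ c) ->
         forall s : R, 0 <= s ->
           mellin mu s =
             ((2 `^ (2 * s) / Num.sqrt pi * (Gamma (s + 1 / 2) / Gamma (s + 2)))
                `^ c)%:E /\
           mellin mu s =
             (((s + 1)^-1 * (Gamma (2 * s + 1) / Gamma (s + 1) ^+ 2))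
                `^ c)%:E)].
Proof.
have rep1 mu : stieltjes_represents mu (catalan R) ->
    stieltjes_represents mu (fun n => catalan R n `^ 1).
  rewrite (_ : (fun n => _) = catalan R)//; apply/funext => n.
  by rewrite powRr1// ltW// catalan_gt0.
have moment (c : R) : 0 < c -> stieltjes_moment (fun n => catalan R n `^ c).
  by move=> /catalan_power_measure_exists[mu [mu_rep _]]; exists mu.
have [nu [nuE nu_rep _]] := @catalan_measure_exists R.
split.
- by split; [exists nu|exact: moment].
- move=> c c0; split; first exact: moment.
  (* Determinacy comes from the geometric bound (4^c)^n on the c-th powers. *)
  by move=> mu la; apply: stieltjes_unique => n; exact: catalan_power_le.
- move=> mu mu_rep A mA; rewrite -nuE//.
  exact: (stieltjes_unique (fun n => catalan_power_le n ltr01) mu_rep (rep1 _ nu_rep)).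
- move=> c mu c0 mu_rep s s0.
  have [la [la_rep la_mellin]] := catalan_power_measure_exists c0.
  (* By determinacy, an arbitrary representing measure has the transform of the constructed one. *)
  rewrite (mellin_unique (fun n => catalan_power_le n c0) mu_rep la_rep) la_mellin//.
  by rewrite -catalan_mellin_duplication.
Qed.
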